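(* Let $(\Omega,\mathcal{F},\mathbb{P})$ be a probability space on which is defined a process $B=(B(t):t\ge 0)$ with distribution $\mathrm{BM}$ (standard Brownian motion started at $0$ with drift $0$). Then, for all $\theta\in\mathbb{R}$, the process $B^{\theta}:=H^{\theta}(B)$ has distribution $\mathrm{BM}^{\theta}$ (Brownian motion started at $0$ with drift $\theta$), and $B,B^{\theta}$ are maximally germ coupled under $\mathbb{P}$, i.e. $$\mathbb{P}\big(\tau_{\mathrm{frag}}(B,B^{\theta})\le t\big)=P\big(4\theta^{-2}Z^2\le t\big)\quad\text{for all } t\ge 0,$$ where $Z$ is a standard Gaussian random variable under $P$.
   Context: $W=C([0,\infty);\mathbb{R})$ is the space of continuous real-valued paths with the topology of uniform convergence on compact sets, and $\mathcal{W}$ is its Borel $\sigma$-algebra. For $\theta\in\mathbb{R}$, $\mathrm{BM}^{\theta}$ is the probability measure on $(W,\mathcal{W})$ which is the law of a one-dimensional Brownian motion started at $0$ with drift $\theta$ (unit variance), i.e. the law of $(b(t)+\theta t)_{t\ge0}$ with $b$ a standard Brownian motion; $\mathrm{BM}:=\mathrm{BM}^{0}$. The fragmentation time of $w_1,w_2\in W$ is $\tau_{\mathrm{frag}}(w_1,w_2):=\inf\{t\ge 0: w_1(t)\ne w_2(t)\}$, with $\inf\emptyset=\infty$. For $\theta\in\mathbb{R}$, the map $H^{\theta}:W\to W$ (reflection across the line $\{(t,\tfrac12\theta t):t\ge0\}$ after the last visit to it) is $$(H^{\theta}(w))(t):=\begin{cases} w(t), & \text{if } t\le \sup\{s\ge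 0: w(s)=\tfrac12\theta s\},\\ \theta t-w(t), & \text{otherwise.}\end{cases}$$ (If $w(0)=0$ the set in the supremum contains $0$; for other paths, if the set is empty its supremum is taken to be $-\infty$.) A coupling of $\mathrm{BM},\mathrm{BM}^{\theta}$ is a pair of processes $B,B^\theta$ on a common probability space $(\Omega,\mathcal F,\mathbb P)$ with $B$ having distribution $\mathrm{BM}$ and $B^{\theta}$ having distribution $\mathrm{BM}^{\theta}$. Any coupling satisfies $\mathbb{P}(\tau_{\mathrm{frag}}(B,B^{\theta})\le t)\ge P(4\theta^{-2}Z^2\le t)$ for all $t\ge0$; a coupling is called maximal germ (and $B,B^\theta$ are called maximally germ coupled under $\mathbb{P}$) if equality holds for all $t\ge 0$. For $\theta=0$, $4\theta^{-2}Z^2$ is read as $+\infty$. *)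

(* Defs.v *)
From HB Require Import structures.
From mathcomp Require Import all_boot all_order all_algebra.
From mathcomp Require Import all_classical all_reals all_analysis.

Set Implicit Arguments.
Unset Strict Implicit.
Unset Printing Implicit Defensive.

Import Order.TTheory GRing.Theory Num.Theory.
Import numFieldNormedType.Exports.

Local Open Scope classical_set_scope.
Local Open Scope ring_scope.

(* The half-line [0, oo) with its subspace topology. *)
Notation time R := (set_type [set t : Real.sort R | 0 <= t]).

Definition time0 {R : realType} : time R :=
  exist _ (0 : R) (mem_set (lexx (0 : R) : [set t : R | 0 <= t] 0)).

HB.instance Definition _ (X : topologicalType) (Y : ptopologicalType) :=
  isPointed.Build (continuousType X Y) (cst point).

(* C([0, oo); R) with the topology of uniform convergence on compact sets. *)
Notation cpath R :=
  (initial_topology (fun w : continuousType (time R) R =>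
     (w : time R -> R) : {family compact, time R -> R})).

(* C([0, oo); R) with its Borel sigma-algebra. *)
Notation W R := (g_sigma_algebraType (@open (cpath R))).

(* Changing the sign of a continuous v after its last zero, along the clock p,
   keeps it continuous. *)
Section reflection_continuity.
Context {R : realType} {T : topologicalType} (p v : T -> R).
Context (cp : continuous p) (cv : continuous v).
Context (nbhs_p : forall t (A : set T), nbhs t A ->
  exists2 e : R, 0 < e & forall s, `|p s - p t| < e -> A s).

Let L : \bar R := ereal_sup [set (p s)%:E | s in [set s | v s = 0]].
Let g t := if ((p t)%:E <= L)%E then v t else - v t.

Lemma reflect_after_continuous : continuous g.
Proof.
have gE s : `|g s| = `|v s| by rewrite /g; case: ifP => // _; rewrite normrN.
have v0L s : v s = 0 -> ((p s)%:E <= L)%E.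
  by move=> vs0; apply: ereal_sup_ubound; exists s.
move=> t; have [vt0|vt0] := eqVneq (v t) 0.
  have gt0 : g t = 0 by rewrite /g v0L.
  rewrite /continuous_at gt0; apply/cvgr0Pnorm_lt => e e0.
  have := @cv t; rewrite /continuous_at vt0 => /cvgr0Pnorm_lt /(_ e e0).
  by apply: filterS => s; rewrite gE.
have vnear : \forall s \near t, v s != 0 by exact: cvgr_neq0 (@cv t) vt0.
have gv : \forall s \near t,
    (if ((p t)%:E <= L)%E then v s else - v s) = g s.
  have [tL|Lt] := leP (p t)%:E L; last first.
    have : \forall s \near t, (L < (p s)%:E)%E.
      case: L Lt => [r||] //= => [|_].
        by rewrite lte_fin => rt; exact: cvgr_gt (@cp t) _ rt.
      by near=> s; rewrite ltNyr.
    by apply: filterS => s Ls; rewrite /g leNgt Ls.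
  have {}tL : ((p t)%:E < L)%E.
    rewrite lt_neqAle tL andbT; apply/eqP => tLE.
    have [e e0 evs] := nbhs_p vnear.
    suff : (L <= (p t - e)%:E)%E by rewrite -tLE lee_fin lerBrDr gerDl leNgt e0.
    apply: ge_ereal_sup => _ [s /= vs0 <-].
    rewrite lee_fin leNgt; apply/negP => es.
    have := v0L _ vs0; rewrite -tLE lee_fin => st.
    suff /evs : `|p s - p t| < e by rewrite vs0 eqxx.
    by rewrite distrC ger0_norm ?subr_ge0// ltrBlDr -ltrBlDl.
  have : \forall s \near t, ((p s)%:E < L)%E.
    case: L tL => [r||] //= => [|_].
      by rewrite lte_fin => rt; exact: cvgr_lt (@cp t) _ rt.
    by near=> s; rewrite ltry.
  by apply: filterS => s /ltW sL; rewrite /g sL.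
apply: cvg_trans; first exact: near_eq_cvg gv.
rewrite /g; case: ifP => _; first exact: cv.
by apply: cvgN; exact: cv.
Unshelve. all: by end_near. Qed.

End reflection_continuity.

Section path_maps.
Context {R : realType}.
Implicit Types (theta : R) (w : W R).

Lemma val_time_continuous : continuous (val : time R -> R).
Proof. exact: initial_continuous. Qed.

Lemma nbhs_val_time (t : time R) (A : set (time R)) : nbhs t A ->
  exists2 e : R, 0 < e & forall s, `|val s - val t| < e -> A s.
Proof.
move/nbhs_ballP => [e /= e0 eA]; exists e => // s ste; apply: eA.
by rewrite /ball /= /initial_ball /ball /= distrC.
Qed.

Lemma W_continuous w : continuous (w : time R -> R).
Proof. exact: (@cts_fun _ _ (w : continuousType (time R) R)). Qed.

Lemma line_continuous (a : R) : continuous (fun t : time R => a * val t).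
Proof.
have gen (T : topologicalType) (f : T -> R) :
  continuous f -> continuous (fun t => a * f t).
  by move=> cf t; apply: cvgMl_tmp; exact: cf.
exact/gen/val_time_continuous.
Qed.

Let continuous_add (T : topologicalType) (f g : T -> R) :
  continuous f -> continuous g -> continuous (fun t => f t + g t).
Proof. by move=> cf cg t; apply: cvgD; [exact: cf|exact: cg]. Qed.

Definition add_drift_fun theta w (t : time R) : R := w t + theta * val t.

Lemma add_drift_continuous theta w : continuous (add_drift_fun theta w).
Proof. exact: continuous_add (@W_continuous w) (@line_continuous theta). Qed.

Definition add_drift theta w : W R := mkcts (@add_drift_continuous theta w).

Definition last_visit theta w : \bar R :=
  ereal_sup [set (val s)%:E | s in
    [set s : time R | w s = 2^-1 * theta * val s]].

Definition Hmap_fun theta w (t : time R) : R :=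
  if ((val t)%:E <= last_visit theta w)%E then w t else theta * val t - w t.

Lemma Hmap_continuous theta w : continuous (Hmap_fun theta w).
Proof.
pose line (t : time R) : R := - (2^-1 * theta) * val t.
pose v (t : time R) : R := w t + line t.
have cv : continuous v.
  exact: continuous_add (@W_continuous w) (@line_continuous _).
have LE : last_visit theta w =
    ereal_sup [set (val s)%:E | s in [set s | v s = 0]].
  congr (ereal_sup (image _ _)); apply/seteqP; split => s /=.
    by move=> ws; rewrite /v /line ws mulNr subrr.
  by rewrite /v /line mulNr => /eqP; rewrite subr_eq0 => /eqP.
have -> : Hmap_fun theta w = (fun t : time R =>
    (if ((val t)%:E <= ereal_sup [set (val s)%:E | s in [set s | v s = 0%R]])%E
     then v t else - v t) + 2^-1 * theta * val t).
  apply/funext => t; rewrite -LE /Hmap_fun /v /line mulNr.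
  case: ifP => _; first by rewrite subrK.
  by rewrite opprB addrAC -!mulrDl -[X in (X + _) * _]mul1r
    -[X in (_ + X) * _]mul1r -splitr mul1r.
apply: continuous_add; last exact: line_continuous.
exact: reflect_after_continuous val_time_continuous cv nbhs_val_time.
Qed.

Definition Hmap theta w : W R := mkcts (@Hmap_continuous theta w).

Definition tau_frag (w1 w2 : W R) : \bar R :=
  ereal_inf [set (val t)%:E | t in [set t : time R | w1 t <> w2 t]].

(* The random variable 4 theta^-2 Z^2 at Z = z, read as +oo when theta = 0. *)
Definition germ_time theta (z : R) : \bar R :=
  if theta == 0 then +oo%E else (4 * theta ^- 2 * z ^+ 2)%:E.

End path_maps.

Definition has_law (d d' : measure_display) (Omega : measurableType d)
    (T : measurableType d') (R : realType) (P : probability Omega R)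
    (X : Omega -> T) (mu : set T -> \bar R) : Prop :=
  measurable_fun setT X /\
  forall A, measurable A -> P (X @^-1` A) = mu A.

(* The product rule for subfamilies follows by taking A i := setT outside the
   subfamily. *)
Definition mutually_independent (d : measure_display)
    (Omega : measurableType d) (R : realType) (P : probability Omega R)
    (n : nat) (X : 'I_n -> Omega -> R) : Prop :=
  forall A : 'I_n -> set R, (forall i, measurable (A i)) ->
    P (\bigcap_(i in [set: 'I_n]) (X i @^-1` A i)) =
    (\prod_(i < n) P (X i @^-1` A i))%E.

Section Brownian.
Context {R : realType} {d : measure_display} {Omega : measurableType d}.
Context (P : probability Omega R).
Implicit Types (X b : Omega -> W R).

Definition independent_increments X : Prop :=
  forall (n : nat) (t : nat -> time R),
    (forall i j, (i <= j)%N -> val (t i) <= val (t j)) ->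
    mutually_independent P (fun (i : 'I_n) x => X x (t i.+1) - X x (t i)).

Definition standard_BM b : Prop :=
  [/\ measurable_fun setT b,
      P [set x | b x time0 = 0] = 1%E,
      independent_increments b
    & forall s t : time R, val s < val t ->
        has_law P (fun x => b x t - b x s)
          (normal_prob 0 (Num.sqrt (val t - val s)))].

End Brownian.

Section Brownian_coupling.
Context {R : realType} {d : measure_display} {Omega : measurableType d}.
Context (P : probability Omega R).

(* X has distribution BM^theta: its law is that of (b(t) + theta t) for some
   standard Brownian motion b, possibly on another probability space. *)
Definition has_BM_law (theta : R) (X : Omega -> W R) : Prop :=
  exists (d' : measure_display) (Omega' : measurableType d')
    (P' : probability Omega' R) (b : Omega' -> W R),
    standard_BM P' b /\
    has_law P X (fun A => P' ((fun x => add_drift theta (b x)) @^-1` A)).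

Definition is_coupling (theta : R) (B Btheta : Omega -> W R) : Prop :=
  has_BM_law 0 B /\ has_BM_law theta Btheta.

Definition maximally_germ_coupled (theta : R) (B Btheta : Omega -> W R) :
    Prop :=
  is_coupling theta B Btheta /\
  forall (d' : measure_display) (Omega' : measurableType d')
    (P' : probability Omega' R) (Z : Omega' -> R),
    has_law P' Z (normal_prob 0 1) ->
    forall t : R, 0 <= t ->
      P [set x | (tau_frag (B x) (Btheta x) <= t%:E)%E] =
      P' [set x | (germ_time theta (Z x) <= t%:E)%E].

End Brownian_coupling.

(* Main.v *)
Require Import Defs.
From HB Require Import structures.
From mathcomp Require Import all_boot all_order all_algebra.
From mathcomp Require Import all_classical all_reals all_analysis.
From mathcomp Require Import measurable_realfun.
From mathcomp Require Import ring lra.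

Set Implicit Arguments.
Unset Strict Implicit.
Unset Printing Implicit Defensive.

Import Order.TTheory GRing.Theory Num.Theory.
Import numFieldNormedType.Exports.

Local Open Scope classical_set_scope.
Local Open Scope ring_scope.

(** Let B be the Brownian motion, c = theta / 2 and X(t) = B(t) - c t.  The
    line is the zero set of X, and seen through X the map H^theta changes the
    sign of the path after its last zero.  The first claim is therefore that
    Brownian motion with drift -c, flipped after its last zero, is Brownian
    motion with drift c.

    The last zero is not a stopping time, and the proof goes through a finite
    horizon T, flipping a path after its last zero before T.  Without drift
    this preserves Wiener measure: when the last zero before T lies between two
    consecutive observation times t_i and t_(i+1), the flipped path agrees at
    all observation times with the path reflected at its first zero after t_i.
    That reflection preserves Wiener measure ([bm_refl_zero]), and it preserves
    the event in question, so that the pieces add up.  With drift, Girsanov's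
    density exp(-c w(T) - c^2 T / 2) is turned into exp(c w(T) - c^2 T / 2),
    because the flipped path has the opposite sign at time T.  Hence the flip
    exchanges the drifts -c and c on [0, T] ([girsanov_measure_flip],
    [flip_until_law]).  At a given time the flipped value does not depend on T
    once T is large, and T -> oo gives [Hmap_law].

    For the second claim, the fragmentation time is the last zero of X.  Let
    c > 0.  By the first claim the flipped path is positive at time t with
    probability P(B(t) + c t > 0).  Paths having a zero after t contribute
    equally to this event and to X(t) > 0.  The other ones have X(t) < 0 almost
    surely, since X(u) <= 0 happens for arbitrarily large u, so they are all
    flipped to positive values.  Subtracting, the probability that there is no
    zero after t is P(- c t < B(t) <= c t) ([no_zero_after_law]), which by
    scaling is the probability that 4 theta^-2 Z^2 is less than t.  For theta = 0 a path without zeros after t does not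
    meet after t one of the lines of slopes e and -e, for every e > 0, and e -> 0
    shows that this has probability 0 ([no_zero_after0]).

    Equality of laws on path space reduces to cylinders, because these generate
    the Borel sigma-algebra ([borel_path]), and then to rectangles in the
    increments along finite grids ([incr_measure_unique]), where independence
    turns everything into one-dimensional Gaussian statements. *)

(** * The time axis *)

Section time_line.
Context {R : realType}.
Implicit Types (w v : W R) (t u : time R).

Lemma time_ge0 t : 0 <= val t.
Proof. by case: t => r /= /set_mem. Qed.

Lemma to_time_subproof (r : R) : Num.max 0 r \in [set t : R | 0 <= t].
Proof. by apply: mem_set; rewrite /= le_max lexx. Qed.

(** Paths are only defined on the half-line; composing with this retraction of
    the real line turns them into functions of a real variable. *)
Definition to_time (r : R) : time R := exist _ (Num.max 0 r) (to_time_subproof r).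

Lemma val_to_time (r : R) : 0 <= r -> val (to_time r) = r.
Proof. by move=> r0; rewrite /= max_r. Qed.

Lemma to_timeK t : to_time (val t) = t.
Proof. by apply: val_inj; rewrite /= max_r ?time_ge0. Qed.

Lemma continuous_time (T : topologicalType) (f : T -> time R) :
  continuous (fun x => val (f x) : R) -> continuous f.
Proof.
move=> cf x A [_ [[B oB <-] /= Bfx BA]].
apply: (@filterS _ (nbhs x) _ _ _ _ (cf x B _)); first by move=> y /BA.
exact: open_nbhs_nbhs.
Qed.

Lemma to_time_continuous : continuous (to_time : R -> time R).
Proof.
apply: continuous_time => r /=.
by apply: (@continuous_max _ _ (fun=> 0) id) => //; exact: cvg_cst.
Qed.

Lemma compact_time (a b : R) : compact [set t : time R | a <= val t <= b].
Proof.
have [a0|a0] := leP 0 a.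
  have -> : [set t : time R | a <= val t <= b] = to_time @` `[a, b]%classic.
    apply/seteqP; split => [t /= tab|t [r /=]].
      by exists (val t); rewrite ?to_timeK//= in_itv.
    by rewrite in_itv/= => /andP[ar rb] <-; rewrite val_to_time ?ar// (le_trans a0).
  apply: continuous_compact; last exact: segment_compact.
  by apply: continuous_subspaceT; exact: to_time_continuous.
have -> : [set t : time R | a <= val t <= b] = to_time @` `[0, b]%classic.
  apply/seteqP; split => [t /= /andP[_ tb]|t [r /=]].
    by exists (val t); rewrite ?to_timeK//= in_itv/= time_ge0.
  by rewrite in_itv/= => /andP[r0 rb] <-; rewrite val_to_time// rb (le_trans (ltW a0)).
apply: continuous_compact; last exact: segment_compact.
by apply: continuous_subspaceT; exact: to_time_continuous.
Qed.

Lemma path_ext w v : (forall t, w t = v t) -> w = v.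
Proof. by move=> wv; apply/continuousEP. Qed.

End time_line.

(** * Borel sets of path space *)

Section path_topology.
Context {R : realType}.
Implicit Types (w v : W R) (t u : time R).

Lemma nbhs_path_compact w (K : set (time R)) (O : set R) :
  compact K -> open O -> (forall t, K t -> O (w t)) ->
  nbhs (w : cpath R) [set v : cpath R | forall t, K t -> O ((v : W R) t)].
Proof.
move=> cK oO wKO.
have ww : continuous (w : time R -> R) by exact: W_continuous.
have wKO' : w @` K `<=` O by move=> _ [t Kt <-]; exact: wKO.
exact: (@initial_continuous _ _ _ (w : cpath R) _ (fam_compact_nbhs oO wKO' cK ww)).
Qed.

(** Compact sets of times are bounded, so uniform closeness on some [0, n]
    suffices for the topology of uniform convergence on compact sets. *)
Lemma nbhs_path_unif w (U : set (W R)) : nbhs (w : cpath R) (U : set (cpath R)) ->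
  exists n : nat, exists2 e : R, 0 < e &
    forall v, (forall t, val t <= n%:R -> `|v t - w t| < e) -> U v.
Proof.
case=> _ [[B oB <-] /= Bw BU].
pose A (n : nat) (e : R) := [set g : time R -> R |
  forall t, val t <= n%:R -> `|g t - w t| < e].
pose F : set_system (time R -> R) :=
  [set X | exists n : nat, exists2 e : R, 0 < e & A n e `<=` X].
have FF : Filter F.
  split.
  - by exists 0%N, 1.
  - move=> X Y [n [e e0 AX]] [n' [e' e'0 AY]].
    exists (maxn n n'), (Num.min e e'); first by rewrite lt_min e0.
    move=> g Ag; split.
      apply: AX => t tn; apply: lt_le_trans (Ag t _) _; last by rewrite ge_min lexx.
      by rewrite (le_trans tn)// ler_nat leq_maxl.
    apply: AY => t tn; apply: lt_le_trans (Ag t _) _; last by rewrite ge_min lexx orbT.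
    by rewrite (le_trans tn)// ler_nat leq_maxr.
  - by move=> X Y XY [n [e e0 AX]]; exists n, e => //; exact: subset_trans XY.
have Fw : {family compact, F --> (w : time R -> R)}.
  apply/fam_cvgP => K cK X /uniform_nbhs [E [entE EX]].
  have [M [_ Mval]] : bounded_set (val @` K : set R).
    apply: compact_bounded; apply: continuous_compact => //.
    by apply: continuous_subspaceT; exact: val_time_continuous.
  have [e /= e0 eE] : \forall e \near 0^'+, forall x y : R, `|x - y| < e -> E (x, y).
    move: entE; rewrite -entourage_ballE => -[e /= e0 eE]; exists e => //= d /=.
    rewrite sub0r normrN => de d0 x y xyd; apply: eE => /=.
    by rewrite /ball/= (lt_trans xyd)// (le_lt_trans _ de)// ler_norm.
  have {}eE : forall x y : R, `|x - y| < e / 2 -> E (x, y).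
    by apply: eE; rewrite /= ?divr_gt0// sub0r normrN gtr0_norm ?divr_gt0// ltr_pdivrMr// ltr_pMr// ltr1n.
  exists (Num.truncn (M + 1)).+1, (e / 2); first by rewrite divr_gt0.
  move=> g Ag; apply: EX => t Kt; apply: eE; rewrite distrC; apply: Ag.
  have := Mval (M + 1); rewrite ltrDl ltr01 => /(_ erefl (val t)) /= tM.
  rewrite (le_trans (ler_norm _))// (le_trans (tM _))//; first by exists t.
  by have := truncnS_gt (M + 1); exact: ltW.
have [|n [e e0 AB]] := Fw B.
  by apply: open_nbhs_nbhs.
by exists n, e => // v vw; apply: BU; apply: AB.
Qed.

Lemma path_mesh w (n : R) (e : R) : 0 < e ->
  exists m : nat, forall t u, val t <= n -> `|val t - val u| < m.+1%:R^-1 ->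
     `|w t - w u| < e.
Proof.
move=> e0; have /compact_near_coveringP := @compact_time R 0 n.
move=> /(_ R (0^'+) (fun d t => forall u, `|val t - val u| < d -> `|w t - w u| < e) _).
case.
  move=> t tn.
  have [d d0 dw] : exists2 d : R, 0 < d & forall s : time R, `|val s - val t| < d -> `|w s - w t| < e / 2.
    apply: nbhs_val_time; have := @W_continuous R w t.
    move/cvgrPdist_lt => /(_ (e / 2)); rewrite divr_gt0// => /(_ isT).
    by apply: filterS => s; rewrite distrC.
  exists ([set s : time R | `|val s - val t| < d / 2], [set r | 0 < r < d / 2]).
    split => /=; last first.
      by near=> r; apply/andP; split; near: r; [exact: nbhs_right_gt|apply: nbhs_right_lt; rewrite divr_gt0].
    have /cvgrPdist_lt/(_ (d / 2)) := @val_time_continuous R t.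
    rewrite divr_gt0// => /(_ isT); by apply: filterS => s; rewrite distrC.
  move=> [s r] /= [sd /andP[r0 rd]] u su.
  rewrite (splitr e) (le_lt_trans (ler_distD (w t) _ _))// ltrD ?dw//.
    by rewrite (lt_trans sd)// ltr_pdivrMr// ltr_pMr// ltr1n.
  rewrite distrC dw// (splitr d) (le_lt_trans (ler_distD (val s) _ _))// ltrD//.
  by rewrite distrC (lt_trans su).
move=> d /= d0 dw; exists (Num.truncn (2 / d)) => t u tn tu.
apply: (dw (d / 2)) => //=.
- by rewrite sub0r normrN gtr0_norm ?divr_gt0// ltr_pdivrMr// ltr_pMr// ltr1n.
- by rewrite divr_gt0.
- by rewrite time_ge0.
- rewrite (lt_trans tu)// -[d / 2]invrK ltf_pV2 ?posrE ?invr_gt0 ?divr_gt0//.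
  by rewrite invf_div truncnS_gt.
Unshelve. all: by end_near. Qed.

End path_topology.

Lemma measurable_forall_count d (T : measurableType d) (I : countType)
    (F : I -> set T) : (forall i, measurable (F i)) ->
  measurable [set x | forall i, F i x].
Proof.
move=> mF; rewrite -[X in measurable X]setCK; apply: measurableC.
have -> : ~` [set x | forall i, F i x] = \bigcup_i (~` F i).
  apply/seteqP; split => [x /existsNP [i nF]|x [i _ nF] /= Fx].
    by exists i.
  exact: nF (Fx i).
apply: countable_bigcupT_measurable; first exact: countableP.
by move=> i; exact: measurableC.
Qed.

Lemma measurable_imply d (T : measurableType d) (b : bool) (F : set T) :
  measurable F -> measurable [set x | b -> F x].
Proof.
case: b => [mF|_].
  have -> : [set x | true -> F x] = F.
    by apply/seteqP; split => x /=; [exact|].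
  exact: mF.
have -> : [set x | false -> F x] = setT by apply/seteqP; split.
exact: measurableT.
Qed.

Section cylinders.
Context {R : realType}.
Implicit Types (w v : W R) (t u : time R).

(** Open half-lines suffice to generate, and they make finite intersections of
    cylinders cylinders again. *)
Definition cylinder (s : seq (time R)) (a : time R -> R) : set (W R) :=
  [set w | forall t, t \in s -> w t < a t].

Definition cylinders : set (set (W R)) := [set C | exists s a, C = cylinder s a].

Lemma cylinders_setI : setI_closed cylinders.
Proof.
move=> _ _ [s [a ->]] [s' [a' ->]].
exists (s ++ s'), (fun t => if t \in s then
  (if t \in s' then Num.min (a t) (a' t) else a t) else a' t).
apply/seteqP; split => [w /= [ws ws'] t|w /= ws].
  rewrite mem_cat; case: ifPn => /= [ts _|_ ts'].
    by case: ifPn => ts'; rewrite ?lt_min ws// ws'.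
  exact: ws'.
split=> t ts; have := ws t; rewrite mem_cat ts ?orbT/= => /(_ isT).
  by case: ifP; rewrite ?lt_min// => _ /andP[].
by case: ifP; rewrite ?lt_min// => _ /andP[].
Qed.

Lemma measurable_eval_cylinders t (D : set (g_sigma_algebraType cylinders)) :
  measurable_fun D (fun w : g_sigma_algebraType cylinders => (w : W R) t).
Proof.
move=> mD; apply: (measurability _ (RGenInftyO.measurableE R)) => //.
move=> _ [_ [x ->] <-]; apply: measurableI => //.
apply: sub_sigma_algebra; exists [:: t], (fun=> x).
apply/seteqP; split => w /=.
  by rewrite in_itv/= => wx u; rewrite inE => /eqP ->.
by move=> /(_ t); rewrite inE eqxx in_itv/= => /(_ isT).
Qed.

(** Countably many measurable sets of small diameter: at the rational times of
    [0, n + 1] the path is within 1 / (k + 1) of the step function with mesh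
    1 / (m + 1) and rational values q.  They replace a countable dense set of
    paths: by uniform continuity every path lies in such a set for every
    precision k, so an open set is the countable union of those that it
    contains. *)
Let mesh_set (i : nat * nat * nat * seq rat) : set (W R) :=
  let: (n, k, m, q) := i in
  [set w | forall r : rat, 0 <= r -> r <= n.+1%:R ->
    `|w (to_time (ratr r)) - ratr (nth 0 q (Num.truncn (m.+1%:R * r)))| <= k.+1%:R^-1].

Let measurable_mesh_set i : <<s cylinders >> (mesh_set i).
Proof.
move: i => [[[n k] m] q] /=.
pose T := g_sigma_algebraType cylinders.
have mle (r : rat) : measurable [set w : T |
    `|(w : W R) (to_time (ratr r)) - ratr (nth 0 q (Num.truncn (m.+1%:R * r)))|
      <= k.+1%:R^-1].
  rewrite -[X in measurable X]setTI; apply: measurable_fun_ler => //.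
  apply: measurableT_comp => //; apply: measurable_funB => //.
  exact: measurable_eval_cylinders.
apply: (@measurable_forall_count _ T) => r.
apply: measurable_imply; apply: measurable_imply; exact: mle.
Qed.

Let mesh_set_close i w v (t : time R) : mesh_set i w -> mesh_set i v -> val t < (i.1.1.1).+1%:R ->
  `|w t - v t| <= 2 / (i.1.1.2).+1%:R.
Proof.
move: i => [[[n k] m] q] /= Ew Ev tn.
rewrite leNgt; apply/negP => kwv.
have cwv : continuous (fun t : time R => `|w t - v t|).
  by move=> s; exact: cvg_norm (cvgB (@W_continuous R w s) (@W_continuous R v s)).
have [d d0 dE] : exists2 d : R, 0 < d & forall s : time R, `|val s - val t| < d ->
    2 / k.+1%:R < `|w s - v s|.
  by apply: nbhs_val_time; exact: cvgr_gt (cwv t) _ kwv.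
have [r] : exists r : rat, ratr r \in `]val t, Num.min (val t + d) n.+1%:R[.
  by apply: rat_in_itvoo; rewrite lt_min ltrDl d0.
rewrite in_itv/= lt_min => /andP[tr /andP[rd rn]].
have r0 : 0 <= r by rewrite -(ler0q R) (le_trans (time_ge0 t))// ltW.
have {}rn : r <= n.+1%:R by rewrite -(ler_rat R) ratr_nat ltW.
have : 2 / k.+1%:R < `|w (to_time (ratr r)) - v (to_time (ratr r))|.
  apply: dE; rewrite val_to_time ?ler0q// gtr0_norm ?subr_gt0//.
  by rewrite ltrBlDl.
apply/negP; rewrite -leNgt.
pose c : R := ratr (nth 0 q (Num.truncn (m.+1%:R * r))).
rewrite (le_trans (ler_distD c _ _))// (_ : 2 / _ = k.+1%:R^-1 + k.+1%:R^-1); last first.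
  by rewrite mulr_natl mulr2n.
by rewrite lerD ?Ew// distrC Ev.
Qed.

Let mesh_set_cover w n k : exists m q, mesh_set (n, k, m, q) w.
Proof.
have e0 : 0 < (k.+1%:R^-1 / 2 : R) by rewrite divr_gt0.
have [m wm] := path_mesh w n.+1%:R e0.
pose near_rat i := [set r : rat | `|w (to_time (i%:R / m.+1%:R)) - ratr r| < k.+1%:R^-1 / 2].
have nr i : exists r, near_rat i r.
  have [r] : exists r : rat, ratr r \in
    `]w (to_time (i%:R / m.+1%:R)), w (to_time (i%:R / m.+1%:R)) + k.+1%:R^-1 / 2[.
    by apply: rat_in_itvoo; rewrite ltrDl.
  rewrite in_itv/= => /andP[wr rw]; exists r.
  by rewrite /near_rat/= distrC gtr0_norm ?subr_gt0// ltrBlDl.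
exists m, (mkseq (fun i => projT1 (cid (nr i))) (n.+1 * m.+1).+1) => r r0 rn /=.
set i := Num.truncn _.
have mr0 : 0 <= m.+1%:R * r by rewrite mulr_ge0.
have /andP[ir ri] := truncn_itv mr0.
have in_ : (i < (n.+1 * m.+1).+1)%N.
  rewrite ltnS -(ler_nat rat) (le_trans ir)// natrM mulrC ler_wpM2r//.
rewrite nth_mkseq//; case: cid => c /= wc.
rewrite (le_trans (ler_distD (w (to_time (i%:R / m.+1%:R))) _ _))//.
rewrite [leRHS]splitr lerD ?(ltW wc)// ltW// wm// !val_to_time ?ler0q ?divr_ge0//.
  by rewrite -(ratr_nat R) ler_rat.
have -> : i%:R / m.+1%:R = ratr (i%:R / m.+1%:R) :> R.
  by rewrite fmorph_div/= !ratr_nat.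
rewrite -rmorphB/= ger0_norm; last first.
  by rewrite ler0q subr_ge0 ler_pdivrMr// mulrC.
rewrite -(ratr_nat R) -fmorphV ltr_rat ltrBlDr -[X in _ < X + _]mul1r -mulrDl.
by rewrite ltr_pdivlMr// mulrC addrC natr1.
Qed.

Lemma cylinder_nil a : cylinder [::] a = setT.
Proof. by apply/seteqP; split. Qed.

Lemma cylinder_cons t s a : cylinder (t :: s) a = [set w : W R | w t < a t] `&` cylinder s a.
Proof.
apply/seteqP; split => [w /= wts|w /= [wt ws] u].
  by split=> [|u us]; apply: wts; rewrite inE ?eqxx ?us ?orbT.
by rewrite inE => /predU1P[->//|]; exact: ws.
Qed.

Lemma open_eval t (O : set R) : open O -> open ([set w : W R | O (w t)] : set (cpath R)).
Proof.
move=> oO; rewrite openE => w /= Owt; rewrite /interior.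
have wO u : [set t] u -> O (w u) by move=> ->.
have : nbhs (w : cpath R) [set v : cpath R | O ((v : W R) t)].
  apply: filterS (@nbhs_path_compact _ w _ _ (@compact_set1 _ t) oO wO).
  by move=> v /(_ t); exact.
by [].
Qed.

(** The open cylinders are open because evaluations are continuous; conversely
    an open set is a countable union of the sets [mesh_set], which are
    determined by the values at rational times. *)
Lemma borel_path (U : set (W R)) : measurable U = <<s cylinders >> U.
Proof.
pose T := g_sigma_algebraType cylinders.
rewrite propeqE; split; last first.
  apply: smallest_sub; first exact: sigma_algebra_measurable.
  move=> _ [s [a ->]].
  elim: s => [|t s ih]; first by rewrite cylinder_nil.
  rewrite cylinder_cons; apply: measurableI => //; apply: sub_sigma_algebra.
  exact: (@open_eval t _ (@open_lt R (a t))).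
apply: smallest_sub; first exact: (@sigma_algebra_measurable _ T).
move=> U' oU.
pose I := [set i | mesh_set i `<=` U'].
have -> : U' = \bigcup_i (if i \in I then mesh_set i else set0).
  apply/seteqP; split => [w Uw|w [i _]]; last first.
    by case: ifPn => // /set_mem; exact.
  have [|n [e e0 eU]] := @nbhs_path_unif R w U'; first exact: open_nbhs_nbhs.
  have [m [q Ew]] := mesh_set_cover w n (Num.truncn (2 / e)).
  exists (n, Num.truncn (2 / e), m, q) => //; rewrite mem_set//.
  move=> v Ev; apply: eU => t tn; apply: (le_lt_trans (mesh_set_close Ev Ew _)) => /=.
    by rewrite (le_lt_trans tn)// ltr_nat.
  by rewrite ltr_pdivrMr// mulrC -ltr_pdivrMr// truncnS_gt.
apply: (@countable_bigcupT_measurable _ T); first exact: countableP.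
by move=> i; case: ifP => _; [exact: measurable_mesh_set|exact: measurable0].
Qed.

End cylinders.

Section path_measurability.
Context {R : realType}.
Implicit Types (w v : W R) (t u : time R).

Lemma measurable_cylinder s a : measurable (@cylinder R s a).
Proof. by rewrite borel_path; apply: sub_sigma_algebra; exists s, a. Qed.

Lemma measurable_eval t : measurable_fun setT (fun w : W R => w t).
Proof.
move=> _ Y mY; rewrite borel_path.
exact: (@measurable_eval_cylinders R t setT (@measurableT _ (g_sigma_algebraType cylinders)) Y mY).
Qed.

(** This is how all maps into path space below are shown to be measurable. *)
Lemma measurable_path d (T : measurableType d) (f : T -> W R) :
  (forall t, measurable_fun setT (fun x => f x t)) -> measurable_fun setT f.
Proof.
move=> mf; apply: (measurability (@cylinders R)).
  by apply/seteqP; split => U; rewrite -borel_path.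
move=> _ [_ [s [a ->]] <-]; rewrite setTI.
elim: s => [|t s ih]; first by rewrite cylinder_nil preimage_setT; exact: measurableT.
rewrite cylinder_cons preimage_setI; apply: measurableI => //.
rewrite -[X in measurable X]setTI.
have -> : f @^-1` [set w : W R | w t < a t] = (fun x => f x t) @^-1` `]-oo, (a t)[%classic.
  by apply/seteqP; split => x; rewrite /= in_itv.
by apply: mf => //; exact: measurable_itv.
Qed.

Lemma measurable_add_drift (c : R) : measurable_fun setT (add_drift c : W R -> W R).
Proof.
apply: measurable_path => t; rewrite /add_drift/=.
by apply: measurable_funD => //; exact: measurable_eval.
Qed.

Definition zeros_in (a b : R) : set (W R) :=
  [set w | exists2 u, a <= val u <= b & w u = 0].

(** By compactness of [a, b], being without zero there is an open condition. *)
Lemma measurable_zeros_in (a b : R) : measurable (zeros_in a b).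
Proof.
rewrite -[X in measurable X]setCK; apply: measurableC; apply: sub_sigma_algebra.
have nW w : ~ zeros_in a b w -> forall t, [set t : time R | a <= val t <= b] t -> w t != 0.
  by move=> nz t /= tab; apply/eqP => wt; apply: nz; exists t.
have oN0 : open [set x : R | x != 0] by exact: open_neq.
rewrite openE => w /= /nW w0; rewrite /interior.
have : nbhs (w : cpath R) [set v : cpath R | forall t : time R,
    [set t : time R | a <= val t <= b] t -> (v : W R) t != 0].
  exact: (@nbhs_path_compact _ w _ _ (@compact_time R a b) oN0 w0).
by apply: filterS => v vz [u uab vu]; have := vz u uab; rewrite vu eqxx.
Qed.

End path_measurability.

Lemma measurable_forall_seq d (T : measurableType d) (I : eqType) (s : seq I)
    (F : I -> set T) : (forall i, i \in s -> measurable (F i)) ->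
  measurable [set x | forall i, i \in s -> F i x].
Proof.
elim: s => [_|i s ih mF].
  have -> : [set x | forall i, i \in [::] -> F i x] = setT.
    by apply/seteqP; split.
  exact: measurableT.
have -> : [set x | forall j, j \in i :: s -> F j x] =
    F i `&` [set x | forall i, i \in s -> F i x].
  apply/seteqP; split => [x Fx|x [Fi Fs] j].
    by split=> [|j js]; apply: Fx; rewrite inE ?eqxx ?js ?orbT.
  by rewrite inE => /predU1P[->//|]; exact: Fs.
apply: measurableI; first by apply: mF; rewrite inE eqxx.
by apply: ih => j js; apply: mF; rewrite inE js orbT.
Qed.

(** * Laws on path space are determined by increments *)

Section path_law_unique.
Context {R : realType}.
Implicit Types (w v : W R) (t u : time R).
Local Open Scope ereal_scope.

Lemma path_measure_unique (m1 m2 : {measure set (W R) -> \bar R}) :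
  m1 setT < +oo -> (forall s a, m1 (cylinder s a) = m2 (cylinder s a)) ->
  forall U, measurable U -> m1 U = m2 U.
Proof.
move=> m1oo m12 U mU.
apply: (@measure_unique _ _ _ (@cylinders R) (fun=> setT)) => //.
- by apply/seteqP; split => V; rewrite -borel_path.
- exact: cylinders_setI.
- by move=> _; exists [::], (fun=> 0%R); rewrite cylinder_nil.
- by apply/seteqP; split => // x _; exists 0%N.
- by move=> _ [s [a ->]].
Qed.

Definition monotone_grid (t : nat -> time R) :=
  forall i j, (i <= j)%N -> (val (t i) <= val (t j))%R.

Definition incr_rect n (t : nat -> time R) (A : nat -> set R) : set (W R) :=
  [set w | forall i, (i < n)%N -> A i (w (t i.+1) - w (t i))%R].

(** The grid lists [D] in increasing order after time 0, and stays constant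
    afterwards. *)
Lemma grid_through (D : seq (time R)) : exists t : nat -> time R,
  [/\ monotone_grid t, t 0%N = time0 & forall d, d \in D -> exists2 k, (k <= size D)%N & t k = d].
Proof.
pose le_time : rel (time R) := fun x y => (val x <= val y)%R.
pose g := sort le_time D.
pose t i := nth time0 (time0 :: g) (minn i (size D)).
have le_total : total le_time by move=> x y; exact: le_total.
have le_tr : transitive le_time by move=> y x z; exact: le_trans.
have sg : sorted le_time (time0 :: g).
  rewrite /= path_min_sorted; first exact: sort_sorted.
  by apply/allP => u _; exact: time_ge0.
exists t; split.
- move=> i j ij; apply: (sorted_leq_nth le_tr _ _ sg) => //.
  + by move=> u; exact: lexx.
  + by rewrite inE /= size_sort ltnS geq_minr.
  + by rewrite inE /= size_sort ltnS geq_minr.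
  + by rewrite leq_min geq_minr andbT (leq_trans (geq_minl _ _)).
- by rewrite /t min0n.
- move=> d dD; have dg : d \in g by rewrite mem_sort.
  exists (index d g).+1; first by rewrite -(size_sort le_time) index_mem.
  rewrite /t (minn_idPl _) /= ?nth_index//.
  by rewrite -(size_sort le_time) index_mem.
Qed.

(** Cylinders are not rectangles in the increments of their own times, but they
    belong to the sigma-algebra generated by these increments, as positions are
    sums of increments from 0.  The freedom to impose grid points [D] lets one
    treat maps which act differently before and after a given time. *)
Lemma incr_measure_unique (D : seq (time R)) (m1 m2 : {measure set (W R) -> \bar R}) :
  m1 setT < +oo ->
  m1 [set w | w time0 != 0%R] = 0 -> m2 [set w | w time0 != 0%R] = 0 ->
  (forall n (t : nat -> time R) A, monotone_grid t -> t 0%N = time0 ->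
     (forall d, d \in D -> exists2 k, (k <= n)%N & t k = d) ->
     (forall i, measurable (A i)) -> m1 (incr_rect n t A) = m2 (incr_rect n t A)) ->
  forall U, measurable U -> m1 U = m2 U.
Proof.
move=> m1oo m10 m20 m12; apply: path_measure_unique => // s a.
have [t [mt t0 tD]] := grid_through (D ++ s).
set n := size (D ++ s) in tD.
pose G := [set C | exists2 A : nat -> set R, (forall i, measurable (A i)) & C = incr_rect n t A].
pose T := g_sigma_algebraType G.
have GI : setI_closed G.
  move=> _ _ [A mA ->] [A' mA' ->]; exists (fun i => A i `&` A' i).
    by move=> i; exact: measurableI.
  apply/seteqP; split => [w [wA wA'] i iN|w wA].
    by split; [exact: wA|exact: wA'].
  by split=> i iN; have [] := wA i iN.
have mincr i : (i < n)%N ->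
    measurable_fun setT (fun w : T => ((w : W R) (t i.+1) - (w : W R) (t i))%R).
  move=> iN _ Y mY; rewrite setTI; apply: sub_sigma_algebra.
  exists (fun j => if j == i then Y else setT); first by move=> j; case: eqP.
  apply/seteqP; split => [w /= wY j jn|w /(_ i iN)].
    by case: eqP => // ->.
  by rewrite eqxx.
have mdiff k : (k <= n)%N ->
    measurable_fun setT (fun w : T => ((w : W R) (t k) - (w : W R) time0)%R).
  elim: k => [_|k ih kn].
    rewrite t0; apply: (@eq_measurable_fun _ _ T R setT (cst (0%R : R))); last exact: measurable_cst.
    by move=> w _; rewrite subrr.
  apply: (eq_measurable_fun (fun w : T => ((w : W R) (t k.+1) - (w : W R) (t k))
     + ((w : W R) (t k) - (w : W R) time0))%R).
    by move=> w _; rewrite addrA subrK.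
  by apply: measurable_funD; [exact: mincr|apply: ih; exact: ltnW].
pose C' := [set w : W R | forall u, u \in s -> (w u - w time0 < a u)%R].
have mC' : <<s G >> C'.
  apply: (@measurable_forall_seq _ T) => u us.
  have [k kn <-] : exists2 k, (k <= n)%N & t k = u.
    by apply: tD; rewrite mem_cat us orbT.
  have := mdiff k kn measurableT _ (@measurable_itv R `]-oo, a (t k)[).
  rewrite setTI; congr (measurable _).
have mincrW A : (forall i, measurable (A i)) -> measurable (incr_rect n t A).
  move=> mA; rewrite (_ : incr_rect n t A =
    [set w | forall i, i \in iota 0 n -> A i (w (t i.+1) - w (t i))%R]).
    apply: measurable_forall_seq => i _; rewrite -[X in measurable X]setTI.
    by apply: measurable_funB => //; exact: measurable_eval.
  apply/seteqP; split => w wA i.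
    by rewrite mem_iota add0n => iN; exact: wA.
  by move=> iN; apply: wA; rewrite mem_iota.
have GW : <<s G >> `<=` measurable.
  apply: smallest_sub; first exact: sigma_algebra_measurable.
  by move=> _ [A mA ->]; exact: mincrW.
have C'E (m : {measure set (W R) -> \bar R}) : m [set w | w time0 != 0%R] = 0 ->
    m C' = m (cylinder s a).
  move=> m0.
  have mN : measurable [set w : W R | w time0 != 0%R].
    rewrite (_ : mkset _ = ~` ((fun w : W R => w time0) @^-1` [set 0%R])).
      apply: measurableC; rewrite -[X in measurable X]setTI.
      by apply: measurable_eval => //; exact: measurable_set1.
    by apply/seteqP; split => w /= /eqP.
  have mle (X Y : set (W R)) : measurable X -> measurable Y ->
      (forall w, w time0 = 0%R -> X w -> Y w) -> m X <= m Y.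
    move=> mX mY XY.
    apply: (@le_trans _ _ (m (Y `|` [set w | w time0 != 0%R]))).
      apply: le_measure; rewrite ?inE//; first exact: measurableU.
      by move=> w Xw; have [w0|w0] := eqVneq (w time0) 0%R; [left; exact: XY|right].
    apply: le_trans; first exact: measureU2.
    by rewrite [X in _ + X]m0 adde0.
  apply/eqP; rewrite eq_le; apply/andP; split; apply: mle.
  - exact: GW.
  - exact: measurable_cylinder.
  - by move=> w w0 wC u us; have := wC u us; rewrite w0 subr0.
  - exact: measurable_cylinder.
  - exact: GW.
  - by move=> w w0 wC u us; have := wC u us; rewrite w0 subr0.
rewrite -C'E// -C'E//.
apply: (@g_sigma_algebra_measure_unique _ _ _ G _ (fun=> setT)) => //.
- by move=> _ [A mA ->]; exact: mincrW.
- by move=> _; exists (fun=> setT) => //; apply/seteqP; split.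
- by apply/seteqP; split => // x _; exists 0%N.
- move=> _ [A mA ->]; apply: m12 => // d dD.
  by apply: tD; rewrite mem_cat dD.
Qed.

End path_law_unique.

(** * Gaussian measures *)

Section normal_affine.
Context {R : realType}.
Local Open Scope ereal_scope.
Local Notation leb := (@lebesgue_measure R).

Let affine (s c : R) : measurableTypeR R -> measurableTypeR R := fun x => (s * x + c)%R.

Let maffine s c : measurable_fun setT (affine s c).
Proof. by apply: measurable_funD => //; exact: measurable_funM. Qed.

Lemma lebesgue_measure_affine (s c : R) (s0 : (0 < s)%R) (A : set (measurableTypeR R)) :
  measurable A -> leb A = s%:E * pushforward leb (affine s c) A.
Proof.
have s0' : (0 <= s)%R by exact: ltW.
pose f : {mfun measurableTypeR R >-> measurableTypeR R} :=
  HB.pack (affine s c) (isMeasurableFun.Build _ _ _ _ _ (maffine s c)).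
move=> mA; apply: (lebesgue_measure_unique (mu := mscale (NngNum s0') (pushforward leb f))) => //.
move=> _ [[a b]] /= _ <-; rewrite /mscale/= /pushforward.
have -> : affine s c @^-1` `]a, b]%classic = `]((a - c) / s)%R, ((b - c) / s)%R]%classic.
  apply/seteqP; split => x /=; rewrite !in_itv/= /affine.
    by rewrite ltr_pdivrMr// ler_pdivlMr// ltrBlDr lerBrDr [(x * s)%R]mulrC.
  by rewrite ltr_pdivrMr// ler_pdivlMr// ltrBlDr lerBrDr [(x * s)%R]mulrC.
rewrite !lebesgue_measure_itv/= !lte_fin ltr_pM2r ?invr_gt0// ltrD2r.
case: ifPn => ab; last by rewrite mule0.
by rewrite -!EFinD -EFinM; congr EFin; field; rewrite gt_eqF.
Qed.

Lemma normal_prob_affine (s c : R) (A : set R) : (0 < s)%R -> measurable A ->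
  normal_prob 0 1 ((fun x => s * x + c)%R @^-1` A) = normal_prob c s A.
Proof.
move=> s0 mA.
have mpdf : measurable_fun setT (fun x => (normal_pdf c s x)%:E).
  by apply/measurable_EFinP; exact: measurable_normal_pdf.
have s0' : (0 <= s)%R by exact: ltW.
pose f : {mfun measurableTypeR R >-> measurableTypeR R} :=
  HB.pack (affine s c) (isMeasurableFun.Build _ _ _ _ _ (maffine s c)).
rewrite /normal_prob.
rewrite [RHS](eq_measure_integral (mscale (NngNum s0') (pushforward leb f))); last first.
  by move=> B mB _; rewrite /mscale/=; exact: lebesgue_measure_affine.
have pdf0 x : 0 <= (normal_pdf c s x)%:E by rewrite lee_fin normal_pdf_ge0.
rewrite ge0_integral_mscale//=; last exact: measurable_funTS.
rewrite ge0_integral_pushforward//; last exact: measurable_funTS.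
have mA' : measurable (affine s c @^-1` A) by rewrite -[X in measurable X]setTI; exact: maffine.
rewrite -ge0_integralZl//=; last first.
- by apply: measurable_funTS; apply: (measurableT_comp mpdf (maffine s c)).
apply: eq_integral => x _.
rewrite /= -EFinM; congr EFin; rewrite !normal_pdfE ?gt_eqF ?oner_eq0//.
rewrite mulrA; congr (_ * _)%R.
  rewrite /normal_peak expr1n mul1r -mulrnAr sqrtrM ?sqr_ge0// sqrtr_sqr gtr0_norm//.
  by rewrite invfM mulrA divff ?gt_eqF// mul1r.
rewrite /normal_fun /affine addrK subr0 expr1n; congr expR.
by field; rewrite gt_eqF.
Qed.

Lemma normal_prob_shift (s c : R) (A : set R) : (0 < s)%R -> measurable A ->
  normal_prob 0 s ((fun x => x + c)%R @^-1` A) = normal_prob c s A.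
Proof.
move=> s0 mA; rewrite -(normal_prob_affine c s0 mA) -(normal_prob_affine 0 s0).
  by congr (normal_prob 0 1); apply/seteqP; split => x; rewrite /= addr0.
by rewrite -[X in measurable X]setTI; apply: measurable_funD.
Qed.

Lemma normal_probN (s : R) (A : set R) : (0 < s)%R -> measurable A ->
  normal_prob 0 s (-%R @^-1` A) = normal_prob 0 s A.
Proof.
move=> s0 mA; rewrite /normal_prob.
have mpdf : measurable_fun setT (fun x => (normal_pdf 0 s x)%:E).
  by apply/measurable_EFinP; exact: measurable_normal_pdf.
have mN : measurable_fun setT (-%R : measurableTypeR R -> measurableTypeR R) by [].
have mA' : measurable ((-%R : measurableTypeR R -> measurableTypeR R) @^-1` A).
  by rewrite -[X in measurable X]setTI; exact: mN.
rewrite [RHS](eq_measure_integral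
    (pushforward leb (-%R : measurableTypeR R -> measurableTypeR R))); last first.
  by move=> B mB _; exact: esym (lebesgue_measureN mB).
rewrite ge0_integral_pushforward; last 3 first.
- exact: mA.
- exact: measurable_funTS mpdf.
- by move=> x _; rewrite lee_fin normal_pdf_ge0.
- apply: eq_integral => x _.
  by rewrite /= !normal_pdfE ?gt_eqF// /normal_fun !subr0 sqrrN.
- exact: mN.
Qed.

(** Cameron-Martin in dimension one: a translation of the centred Gaussian
    measure multiplies its density by an exponential. *)
Lemma normal_prob_tilt (s c : R) (A : set R) : (0 < s)%R -> measurable A ->
  normal_prob 0 s ((fun x => x + c * s ^+ 2)%R @^-1` A) =
  \int[leb]_(x in A) ((expR (c * x - c ^+ 2 * s ^+ 2 / 2))%:E * (normal_pdf 0 s x)%:E).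
Proof.
move=> s0 mA; rewrite normal_prob_shift//; apply: eq_integral => x _.
rewrite -EFinM !normal_pdfE ?gt_eqF// [in RHS]mulrCA; congr (_ * _)%:E.
rewrite /normal_fun -expRD; congr expR; field.
by rewrite gt_eqF.
Qed.

End normal_affine.

(** * Densities and products of independent variables *)

Section density.
Context d d' (T : measurableType d) (T' : measurableType d') (R : realType).
Local Open Scope ereal_scope.
Import HBNNSimple.

(** Image measures and measures with density at the same time: true for
    indicators by hypothesis, for simple functions by linearity, and in general
    by monotone convergence. *)
Lemma ge0_integral_density (mu : {measure set T -> \bar R})
    (m : {measure set T' -> \bar R}) (phi : T -> T') (h : T -> R) :
  measurable_fun setT phi -> measurable_fun setT h -> (forall x, (0 <= h x)%R) ->
  (forall A, measurable A -> m A = \int[mu]_(x in phi @^-1` A) (h x)%:E) ->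
  forall f : T' -> \bar R, measurable_fun setT f -> (forall y, 0 <= f y) ->
  \int[m]_y f y = \int[mu]_x (f (phi x) * (h x)%:E).
Proof.
move=> mphi mh h0 mE f mf f0.
have mpre A : measurable A -> measurable (phi @^-1` A).
  by move=> mA; rewrite -[X in measurable X]setTI; exact: mphi.
pose g := nnsfun_approx measurableT mf.
have gf y : (g n y)%:E @[n --> \oo] --> f y by exact: cvg_nnsfun_approx.
have ndg y : {homo (fun n => (g n y)%:E) : a b / (a <= b)%N >-> a <= b}.
  by move=> a b ab; rewrite lee_fin; exact/lefP/nd_nnsfun_approx.
transitivity (limn (fun n => \int[m]_y (g n y)%:E)).
  rewrite -monotone_convergence//.
  - by apply: eq_integral => y _; apply/esym/cvg_lim => //; exact: gf.
  - by move=> n; exact/measurable_EFinP.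
  - by move=> n y _; rewrite lee_fin.
transitivity (limn (fun n => \int[mu]_x ((g n (phi x))%:E * (h x)%:E))); last first.
  rewrite -monotone_convergence//.
  - apply: eq_integral => x _; apply/cvg_lim => //.
    by apply: cvgeZr => //; exact: gf.
  - move=> n; apply: emeasurable_funM; apply/measurable_EFinP => //.
    exact: measurableT_comp.
  - by move=> n x _; rewrite mule_ge0// lee_fin.
  - by move=> x _ a b ab; rewrite lee_wpmul2r ?lee_fin//; exact: ndg.
apply: congr_lim; apply/funext => n.
rewrite integralT_nnsfun sintegralE.
have k0 k : range (g n) k -> (0 <= k)%R by move=> [y _ <-].
have mk k : measurable (g n @^-1` [set k]) by [].
have m1 k : measurable_fun setT (fun x => \1_(g n @^-1` [set k]) (phi x) : R).
  have m1' : measurable_fun setT (\1_(g n @^-1` [set k]) : T' -> R) by exact: measurable_indic.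
  exact: (measurableT_comp m1' mphi).
transitivity (\int[mu]_x (\sum_(k \in range (g n))
    (k%:E * ((h x)%:E * (\1_(g n @^-1` [set k]) (phi x))%:E)))); last first.
  apply: eq_integral => x _; rewrite fimfunE -fsumEFin// ge0_mule_fsuml; last first.
    by move=> k; exact: nnfun_muleindic_ge0.
  by apply: eq_fsbigr => k _; rewrite EFinM -muleA [in RHS](muleC (_%:E) (h x)%:E).
rewrite ge0_integral_fsum//; last 2 first.
- move=> k; apply: emeasurable_funM => //; apply: emeasurable_funM; exact/measurable_EFinP.
- move=> k x _; have [k0'|k0'] := leP 0%R k.
    by rewrite !mule_ge0 ?lee_fin.
  rewrite indicE memNset ?mule0//= => gk.
  by have := k0 k (ex_intro2 _ _ (phi x) I gk); rewrite leNgt k0'.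
apply: eq_fsbigr => k /[!inE] gk.
rewrite ge0_integralZl//; last 3 first.
- apply: emeasurable_funM; exact/measurable_EFinP.
- by move=> x _; rewrite mule_ge0 ?lee_fin.
- by rewrite lee_fin k0.
rewrite mE//; congr (_ * _); rewrite integral_mkcond; apply: eq_integral => x _.
rewrite patchE indicE; have -> : (phi x \in g n @^-1` [set k]) = (x \in phi @^-1` (g n @^-1` [set k])).
  by apply/idP/idP; rewrite !inE.
by case: ifP => _; rewrite ?mule1 ?mule0.
Qed.

End density.

Section independent_product.
Context d (T : measurableType d) (R : realType) (P : probability T R).
Context (n : nat) (xi : nat -> T -> R).
Context (mxi : forall i, measurable_fun setT (xi i)).
Context (indep : forall A : nat -> set R, (forall i, measurable (A i)) ->
  P [set x | forall i, (i < n)%N -> A i (xi i x)] =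
  (\prod_(i < n) P (xi i @^-1` A i))%E).
Local Open Scope ereal_scope.

Let mpre i A : measurable A -> measurable (xi i @^-1` A).
Proof. by move=> mA; rewrite -[X in measurable X]setTI; exact: mxi. Qed.

(** Starting from the product rule for events, the indicators are replaced by
    the functions [f i] one index at a time. *)
Lemma integral_prod_independent (f : nat -> R -> R) (c : nat -> R) :
  (forall i, measurable_fun setT (f i)) -> (forall i x, (0 <= f i x)%R) ->
  (forall i, (i < n)%N -> \int[P]_x (f i (xi i x))%:E = (c i)%:E) ->
  \int[P]_x (\prod_(i < n) f i (xi i x))%:E = (\prod_(i < n) c i)%:E.
Proof.
move=> mf f0 fc.
pose F k (A : nat -> set R) i : R -> R := if (i < k)%N then f i else \1_(A i).
pose C k (A : nat -> set R) i := if (i < k)%N then c i else fine (P (xi i @^-1` A i)).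
have mF k A i : (forall i, measurable (A i)) -> measurable_fun setT (F k A i).
  by move=> mA; rewrite /F; case: ifP.
have F0 k A i x : (0 <= F k A i x)%R by rewrite /F; case: ifP.
suff claim k A : (k <= n)%N -> (forall i, measurable (A i)) ->
    \int[P]_x (\prod_(i < n) F k A i (xi i x))%:E = (\prod_(i < n) C k A i)%:E.
  have := claim n (fun=> setT) (leqnn n) (fun=> measurableT).
  rewrite (eq_bigr (fun i : 'I_n => c i)); last by move=> i _; rewrite /C ltn_ord.
  move=> <-; apply: eq_integral => x _; congr EFin; apply: eq_bigr => i _.
  by rewrite /F ltn_ord.
elim: k A => [|k ih] A kn mA.
  have CP i : (C 0%N A i)%:E = P (xi i @^-1` A i).
    by rewrite /C/= fineK// fin_num_measure//; exact: mpre.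
  rewrite -prodEFin (eq_bigr _ (fun (i : 'I_n) _ => CP i)).
  rewrite -indep//; set S := [set x | _].
  have mS : measurable S.
    have -> : S = [set x | forall i, i \in iota 0 n -> (xi i @^-1` A i) x].
      apply/seteqP; split => x Sx i; first by rewrite mem_iota => /Sx.
      by move=> iN; apply: Sx; rewrite mem_iota.
    by apply: measurable_forall_seq => i _; exact: mpre.
  rewrite -(setIT S) -integral_indic//; apply: eq_integral => x _; congr EFin.
  rewrite indicE; have [Sx|/negP Sx] := boolP (x \in S).
    rewrite big1// => i _; rewrite /F/= indicE mem_set//.
    by move: Sx; rewrite inE => /(_ i (ltn_ord i)).
  have [i iA] : exists i : 'I_n, ~ A i (xi i x).
    apply: contrapT => /forallNP AA; apply: Sx; rewrite inE => i iN.
    exact: contrapT (AA (Ordinal iN)).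
  by rewrite (bigD1 i)//= /F/= indicE memNset// mul0r.
pose kk := Ordinal kn.
pose h x := (\prod_(i < n | i != kk) F k.+1 A i (xi i x))%R.
pose D := (\prod_(i < n | i != kk) C k.+1 A i)%R.
pose sub B i := if i == k then B else A i.
have msub B : measurable B -> forall i, measurable (sub B i) by move=> mB i; rewrite /sub; case: ifP.
have ltk (i : 'I_n) : i != k :> nat -> (i < k.+1)%N = (i < k)%N.
  by move=> ik; rewrite ltnS leq_eqVlt (negbTE ik).
have FE B x : (\prod_(i < n) F k (sub B) i (xi i x))%R = (\1_B (xi k x) * h x)%R.
  rewrite (bigD1 kk)//=; congr (_ * _)%R; first by rewrite /F ltnn /sub eqxx.
  apply: eq_bigr => i ik; have {}ik : (i != k :> nat) by [].
  by rewrite /F /sub (negbTE ik) ltk.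
have CE B : (\prod_(i < n) C k (sub B) i)%R = (fine (P (xi k @^-1` B)) * D)%R.
  rewrite (bigD1 kk)//=; congr (_ * _)%R; first by rewrite /C ltnn /sub eqxx.
  apply: eq_bigr => i ik; have {}ik : (i != k :> nat) by [].
  by rewrite /C /sub (negbTE ik) ltk.
have D0 : (0 <= D)%R.
  apply: prodr_ge0 => i _; rewrite /C; case: ifP => // _; last by rewrite fine_ge0.
  by rewrite -lee_fin -fc// integral_ge0// => x _; rewrite lee_fin.
have mh : measurable_fun setT h.
  apply: (@eq_measurable_fun _ _ T R setT (fun x =>
      (\prod_(i < n) (if i != kk then F k.+1 A i (xi i x) else 1))%R)).
    by move=> x _; rewrite /h [RHS]big_mkcond.
  apply: measurable_prod => i _; case: (i != kk) => //.
  by apply: measurableT_comp => //; exact: mF.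
have h0 x : (0 <= h x)%R by apply: prodr_ge0 => i _.
pose X : {mfun T >-> R} := HB.pack (xi k) (isMeasurableFun.Build _ _ _ _ _ (mxi k)).
have key := @ge0_integral_density _ _ T R R P (mscale (NngNum D0) (distribution P X)) X h (mxi k) mh h0.
have {}key : \int[mscale (NngNum D0) (distribution P X)]_y (f k y)%:E =
    \int[P]_x ((f k (X x))%:E * (h x)%:E).
  apply: (key _ (fun y => (f k y)%:E)) => //; last 2 first.
  - exact/measurable_EFinP.
  - by move=> y; rewrite lee_fin.
  move=> B mB; transitivity (D%:E * P (xi k @^-1` B)); first by [].
  rewrite -[X in _ * X]fineK ?fin_num_measure//; last exact: mpre.
  rewrite -EFinM mulrC -CE -(ih (sub B))//; last 2 first.
  - exact: ltnW.
  - exact: msub.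
  rewrite [in RHS]integral_mkcond; apply: eq_integral => x _.
  rewrite FE patchE indicE.
  have -> : (xi k x \in B) = (x \in X @^-1` B) by apply/idP/idP; rewrite !inE.
  by case: ifP => _; rewrite ?mul1r ?mul0r.
transitivity (\int[P]_x ((f k (X x))%:E * (h x)%:E)).
  apply: eq_integral => x _; rewrite -EFinM; congr EFin.
  by rewrite (bigD1 kk)//=; congr (_ * _)%R; rewrite /F ltnSn.
(* The other factors weight the law of [xi k] by the constant [D]. *)
rewrite -key ge0_integral_mscale//=; last 2 first.
- exact/measurable_EFinP.
- by move=> y _; rewrite lee_fin.
rewrite ge0_integral_pushforward//; last 2 first.
- exact/measurable_EFinP.
- by move=> y _; rewrite lee_fin.
rewrite [X in _ * X](fc k)// -EFinM mulrC (bigD1 kk)//=.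
by congr (_ * _)%:E; rewrite /C ltnSn.
Qed.

End independent_product.

Section weighted_measure.
Context d (T : measurableType d) (R : realType) (mu : {measure set T -> \bar R}).
Context (g : T -> R) (mg : measurable_fun setT g) (g0 : forall x, 0 <= g x).
Local Open Scope ereal_scope.

(** The proofs are arguments so that the measure structure can be inferred. *)
Definition density_measure of measurable_fun setT g & forall x, (0 <= g x)%R :=
  fun A : set T => \int[mu]_(x in A) (g x)%:E.

Let density_measure0 : density_measure mg g0 set0 = 0.
Proof. exact: integral_set0. Qed.

Let density_measure_ge0 A : 0 <= density_measure mg g0 A.
Proof. by apply: integral_ge0 => x _; rewrite lee_fin. Qed.

Let density_measure_sigma_additive : semi_sigma_additive (density_measure mg g0).
Proof.
move=> F mF tF mUF; rewrite /density_measure ge0_integral_bigcup//=.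
- by apply: is_cvg_nneseries => n _ _; apply: integral_ge0 => x _; rewrite lee_fin.
- by apply: measurable_funTS; exact/measurable_EFinP.
- by move=> x _; rewrite lee_fin.
Qed.

HB.instance Definition _ := isMeasure.Build _ _ _ (density_measure mg g0)
  density_measure0 density_measure_ge0 density_measure_sigma_additive.

End weighted_measure.

(** * Wiener measure *)

Section brownian_measure.
Context {R : realType} (nu : probability (W R) R).
Context (bm : standard_BM nu (fun w : W R => w)).
Implicit Types (w : W R) (s t : time R).
Local Open Scope ereal_scope.

Lemma measurable_incr s t : measurable_fun setT (fun w : W R => (w t - w s)%R).
Proof. exact: (measurable_funB (@measurable_eval R t) (@measurable_eval R s)). Qed.

Lemma measurable_incr_set s t (A : set R) : measurable A ->
  measurable [set w : W R | A (w t - w s)%R].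
Proof.
by move=> mA; rewrite -[X in measurable X]setTI; exact: (measurable_incr s t).
Qed.

Lemma bm_start : nu [set w | w time0 != 0%R] = 0.
Proof.
have [_ b0 _ _] := bm.
have mS : measurable [set w : W R | w time0 = 0%R].
  by rewrite -[X in measurable X]setTI; exact: (@measurable_eval R time0 measurableT [set 0%R] (measurable_set1 _)).
rewrite [X in nu X](_ : _ = ~` [set w : W R | w time0 = 0%R]); last first.
  by apply/seteqP; split => w /= /eqP.
by rewrite probability_setC// [X in 1 - X]b0 subee.
Qed.

Lemma bm_rect n (t : nat -> time R) (A : nat -> set R) : monotone_grid t ->
  (forall i, measurable (A i)) ->
  nu (incr_rect n t A) = \prod_(i < n) nu [set w | A i (w (t i.+1) - w (t i))%R].
Proof.
move=> mt mA; have [_ _ indep _] := bm.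
rewrite -(indep n t mt (fun i : 'I_n => A i))//; congr (nu _).
apply/seteqP; split => [w wA i _|w wA i iN]; first exact: wA.
exact: (wA (Ordinal iN)).
Qed.

Lemma bm_increment_law s t (A : set R) : (val s < val t)%R -> measurable A ->
  nu [set w | A (w t - w s)%R] = normal_prob 0 (Num.sqrt (val t - val s)) A.
Proof. by move=> st mA; have [_ _ _ /(_ s t st)[_]] := bm; exact. Qed.

Lemma bm_increment_sym s t (A : set R) : (val s <= val t)%R -> measurable A ->
  nu [set w | A (- (w t - w s))%R] = nu [set w | A (w t - w s)%R].
Proof.
move=> + mA; rewrite le_eqVlt => /predU1P[/val_inj ->|st].
  by congr (nu _); apply/seteqP; split => w /=; rewrite subrr oppr0.
have mNA : measurable (-%R @^-1` A).
  have mN : measurable_fun setT (-%R : R -> R) by [].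
  by rewrite -[X in measurable X]setTI; exact: mN.
rewrite (bm_increment_law st mNA) (bm_increment_law st mA) normal_probN//.
by rewrite sqrtr_gt0 subr_gt0.
Qed.

(** To recognise Wiener measure it is enough to look at grids through [D]. *)
Lemma bm_unique (D : seq (time R)) (m : {measure set (W R) -> \bar R}) :
  m [set w | w time0 != 0%R] = 0 ->
  (forall n (t : nat -> time R) A, monotone_grid t -> t 0%N = time0 ->
     (forall d, d \in D -> exists2 k, (k <= n)%N & t k = d) ->
     (forall i, measurable (A i)) ->
     m (incr_rect n t A) = \prod_(i < n) nu [set w | A i (w (t i.+1) - w (t i))%R]) ->
  forall U, measurable U -> m U = nu U.
Proof.
move=> m0 mE U mU; apply/esym.
apply: (@incr_measure_unique _ D nu m) => //.
- by rewrite (le_lt_trans (probability_le1 nu measurableT))// ltry.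
- exact: bm_start.
- by move=> n t A mt t0 tD mA; exact: etrans (bm_rect n mt mA) (esym (mE n t A mt t0 tD mA)).
Qed.

Lemma measurable_start : measurable [set w : W R | w time0 != 0%R].
Proof.
have -> : [set w : W R | w time0 != 0%R] = ~` [set w : W R | w time0 = 0%R].
  by apply/seteqP; split => w /= /eqP.
apply: measurableC; rewrite -[X in measurable X]setTI.
by exact: (@measurable_eval R time0 measurableT [set 0%R] (measurable_set1 _)).
Qed.

End brownian_measure.

(** * Reflecting and drifting from a given time on *)

Section stopped_maps.
Context {R : realType}.
Implicit Types (w : W R) (t u s : time R).

Definition time_min t s : time R := to_time (Num.min (val t) (val s)).

Lemma val_time_min t s : val (time_min t s) = Num.min (val t) (val s).
Proof. by rewrite val_to_time// le_min !time_ge0. Qed.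

Lemma time_min_l t s : val t <= val s -> time_min t s = t.
Proof. by move=> ts; apply: val_inj; rewrite val_time_min min_l. Qed.

Lemma time_min_r t s : val s <= val t -> time_min t s = s.
Proof. by move=> ts; apply: val_inj; rewrite val_time_min min_r. Qed.

Lemma continuous_val_min s : continuous (fun t : time R => Num.min (val t) (val s)).
Proof.
have cc : continuous (fun _ : time R => (val s : R)) by exact: cst_continuous.
by move=> t; exact: (continuous_min (@val_time_continuous R t) (cc t)).
Qed.

Lemma time_min_continuous s : continuous (time_min ^~ s).
Proof.
apply: continuous_time => t /=.
rewrite (_ : (fun x => _) = (fun x : time R => Num.min (val x) (val s))); last first.
  by apply/funext => x; rewrite [LHS]val_time_min.
exact: continuous_val_min.
Qed.

(** The path reflected at the level w(s) from time s on.  Writing it with the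
    stopped path makes continuity in t and in s immediate. *)
Definition refl_fun s w t : R := 2 * w (time_min t s) - w t.

Lemma refl_continuous s w : continuous (refl_fun s w).
Proof.
have cm : continuous (fun t => w (time_min t s)).
  move=> t; apply: (@continuous_comp _ _ _ (time_min ^~ s) w); first exact: time_min_continuous.
  exact: (@W_continuous R w).
have gen (T : topologicalType) (f g : T -> R) :
    continuous f -> continuous g -> continuous (fun x => 2 * f x - g x).
  by move=> cf cg x; apply: cvgB; [apply: cvgMl_tmp; exact: cf|exact: cg].
exact: gen cm (@W_continuous R w).
Qed.

Definition refl s w : W R := mkcts (@refl_continuous s w).

Lemma reflE s w t : refl s w t = 2 * w (time_min t s) - w t.
Proof. by []. Qed.

Lemma refl_before s w t : val t <= val s -> refl s w t = w t.
Proof. by move=> ts; rewrite reflE time_min_l//; ring. Qed.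

Lemma refl_after s w t : val s <= val t -> refl s w t = 2 * w s - w t.
Proof. by move=> ts; rewrite reflE time_min_r. Qed.

Lemma measurable_refl s : measurable_fun setT (refl s).
Proof.
apply: measurable_path => t; rewrite /refl/= /mkcts /refl_fun.
apply: measurable_funB; last exact: measurable_eval.
by apply: measurable_funM => //; exact: measurable_eval.
Qed.

Definition drift_until_fun (c : R) s w t : R := w t + c * Num.min (val t) (val s).

Lemma drift_until_continuous c s w : continuous (drift_until_fun c s w).
Proof.
have cm : continuous (fun t : time R => Num.min (val t) (val s)).
  exact: continuous_val_min.
have gen (T : topologicalType) (f g : T -> R) :
    continuous f -> continuous g -> continuous (fun x => f x + c * g x).
  by move=> cf cg x; apply: cvgD; [exact: cf|apply: cvgMl_tmp; exact: cg].
exact: gen (@W_continuous R w) cm.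
Qed.

Definition drift_until c s w : W R := mkcts (@drift_until_continuous c s w).

Lemma measurable_drift_until c s : measurable_fun setT (drift_until c s).
Proof.
apply: measurable_path => t; rewrite /drift_until/= /mkcts /drift_until_fun.
by apply: measurable_funD => //; exact: measurable_eval.
Qed.

End stopped_maps.

Section reflection_principle.
Context {R : realType} (nu : probability (W R) R).
Context (bm : standard_BM nu (fun w : W R => w)).
Implicit Types (w : W R) (s t : time R).
Local Open Scope ereal_scope.

(** On a grid through s, reflection only changes the signs of the increments
    after s, and these are symmetric. *)
Lemma bm_refl s U : measurable U -> nu (refl s @^-1` U) = nu U.
Proof.
pose f : {mfun W R >-> W R} := HB.pack (refl s) (isMeasurableFun.Build _ _ _ _ _ (measurable_refl s)).
move=> mU; apply: (@bm_unique _ nu bm [:: s] (distribution nu f)) => //.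
- rewrite -[RHS](bm_start bm); congr (nu _); apply/seteqP; split => w /=.
    by rewrite refl_before// time_ge0.
  by rewrite refl_before// time_ge0.
move=> n t A mt t0 tD mA.
have [|k kn tk] := tD s; first by rewrite inE.
have mNA i : measurable (-%R @^-1` A i).
  have mN : measurable_fun setT (-%R : R -> R) by [].
  by rewrite -[X in measurable X]setTI; exact: mN.
transitivity (nu (incr_rect n t (fun i => if (i < k)%N then A i else -%R @^-1` A i))).
  have incrE w i : (refl s w (t i.+1) - refl s w (t i))%R =
      if (i < k)%N then (w (t i.+1) - w (t i))%R else (- (w (t i.+1) - w (t i)))%R.
    case: ltnP => ik.
      by rewrite !refl_before// -tk; apply: mt => //; exact: ltnW.
    rewrite !refl_after; [by ring| |].
      by rewrite -tk; apply: mt.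
    by rewrite -tk; apply: mt; exact: leqW.
  congr (nu _); apply/seteqP; split => w /= wA i iN; have := wA i iN;
    by rewrite incrE; case: ifP.
rewrite bm_rect//; last by move=> i; case: ifP.
apply: eq_bigr => i _; case: ifP => // _.
by apply: bm_increment_sym => //; apply: mt.
Qed.

End reflection_principle.

(** * The Girsanov formula *)

Section cameron_martin.
Context {R : realType} (nu : probability (W R) R).
Context (bm : standard_BM nu (fun w : W R => w)).
Implicit Types (w : W R) (s t : time R).
Local Open Scope ereal_scope.

Definition girsanov_density (c : R) (s : time R) (w : W R) : R :=
  expR (c * (w s - w time0) - c ^+ 2 * val s / 2).

Lemma measurable_girsanov_density c s : measurable_fun setT (girsanov_density c s).
Proof.
apply: measurableT_comp => //; apply: measurable_funB => //.
by apply: measurable_funM => //; exact: measurable_incr.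
Qed.

Lemma girsanov_density_ge0 c s w : (0 <= girsanov_density c s w)%R.
Proof. exact: expR_ge0. Qed.

Let incr_tilt (c : R) s t (A : set R) : (val s <= val t)%R -> measurable A ->
  \int[nu]_w (expR (c * (w t - w s) - c ^+ 2 * (val t - val s) / 2) * \1_A (w t - w s))%:E =
  nu [set w | A (w t - w s + c * (val t - val s))%R].
Proof.
rewrite le_eqVlt => /predU1P[/val_inj -> mA|st mA].
  pose S := [set w : W R | A (w t - w t + c * (val t - val t))%R].
  have mS : measurable S.
    pose A' := [set x : R | A (x + c * (val t - val t))%R].
    have mA' : measurable A' by rewrite -[X in measurable X]setTI; apply: measurable_funD.
    exact: (measurable_incr_set t t mA').
  transitivity (\int[nu]_w (\1_S w)%:E); last by rewrite integral_indic// setIT.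
  apply: eq_integral => w _; congr EFin.
  rewrite !indicE /S !subrr !mulr0 mul0r subr0 expR0 mul1r; congr ((nat_of_bool _)%:R).
  by apply/idP/idP; rewrite !inE/= ?subrr ?mulr0 ?addr0 ?subrr ?mulr0 ?addr0.
pose X' : W R -> measurableTypeR R := fun w => (w t - w s)%R.
have mX' : measurable_fun setT X' by exact: measurable_incr.
pose X : {mfun W R >-> measurableTypeR R} := HB.pack X' (isMeasurableFun.Build _ _ _ _ _ mX').
pose sd := Num.sqrt (val t - val s).
have sd0 : (0 < sd)%R by rewrite sqrtr_gt0 subr_gt0.
have sd2 : (sd ^+ 2 = val t - val s)%R by rewrite sqr_sqrtr// ltW// subr_gt0.
pose g x := expR (c * x - c ^+ 2 * (val t - val s) / 2).
have mg : measurable_fun setT (fun x : R => g x * \1_A x)%R.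
  apply: measurable_funM; last exact: measurable_indic.
  by apply: measurableT_comp => //; apply: measurable_funB => //; exact: measurable_funM.
have g0 (x : R) : 0 <= (g x * \1_A x)%:E by rewrite lee_fin mulr_ge0// expR_ge0.
transitivity (\int[distribution nu X]_x (g x * \1_A x)%:E).
  rewrite ge0_integral_pushforward//; exact/measurable_EFinP.
transitivity (\int[normal_prob 0 sd]_x (g x * \1_A x)%:E).
  by apply: (eq_measure_integral (normal_prob 0 sd)) => B mB _; exact: bm_increment_law.
rewrite (@ge0_integral_density _ _ _ _ R lebesgue_measure (normal_prob 0 sd) idfun (normal_pdf 0 sd))//; last 3 first.
- exact: measurable_normal_pdf.
- by move=> x; exact: normal_pdf_ge0.
- exact/measurable_EFinP.
have mA' : measurable ((fun x => x + c * sd ^+ 2)%R @^-1` A).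
  by rewrite -[X in measurable X]setTI; apply: measurable_funD.
transitivity (normal_prob 0 sd ((fun x => x + c * sd ^+ 2)%R @^-1` A)); last first.
  by rewrite -(bm_increment_law bm st mA') sd2.
rewrite normal_prob_tilt// [RHS]integral_mkcond; apply: eq_integral => x _.
rewrite patchE -EFinM /g -sd2.
by have [xA|xA] := boolP (x \in A); rewrite indicE ?xA ?mulr1// (negbTE xA) mulr0 mul0r.
exact: measurable_id.
Qed.

Lemma drift_untilE c s w t :
  drift_until c s w t = (w t + c * Num.min (val t) (val s))%R.
Proof. by []. Qed.

Lemma drift_until_start c s w : drift_until c s w time0 = w time0.
Proof. by rewrite drift_untilE min_l ?time_ge0// mulr0 addr0. Qed.

(** On a grid through the time s the density is a product over the increments
    before s, so that the formula splits into one-dimensional ones. *)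
Lemma girsanov (c : R) (s : time R) U : measurable U ->
  nu (drift_until c s @^-1` U) = \int[nu]_(w in U) (girsanov_density c s w)%:E.
Proof.
pose f : {mfun W R >-> W R} := HB.pack (drift_until c s)
  (isMeasurableFun.Build _ _ _ _ _ (measurable_drift_until c s)).
pose m2 := density_measure nu (measurable_girsanov_density c s) (@girsanov_density_ge0 c s).
move=> mU; apply: (@incr_measure_unique _ [:: s] (distribution nu f) m2) => //.
- by rewrite (le_lt_trans (probability_le1 (distribution nu f) measurableT))// ltry.
- rewrite -[RHS](bm_start bm); congr (nu _); apply/seteqP; split => w /=.
    by rewrite drift_until_start.
  by rewrite drift_until_start.
- apply: null_set_integral; first exact: measurable_start.
    apply: measurable_funTS; apply/measurable_EFinP; exact: measurable_girsanov_density.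
  exact: bm_start.
move=> n t A mt t0 tD mA.
have [|k kn tk] := tD s; first by rewrite inE.
pose e i : R := (if (i < k)%N then c * (val (t i.+1) - val (t i)) else 0)%R.
have incrE w i : (drift_until c s w (t i.+1) - drift_until c s w (t i) =
    w (t i.+1) - w (t i) + e i)%R.
  rewrite !drift_untilE /e; case: ltnP => ik.
    rewrite !min_l -?tk; [by ring|apply: mt; exact: ltnW|exact: mt].
  rewrite !min_r -?tk; [by ring|exact: mt|apply: mt; exact: leqW].
transitivity (\prod_(i < n) nu [set w | A i (w (t i.+1) - w (t i) + e i)%R]).
  pose A' i := [set x | A i (x + e i)%R].
  have mA' i : measurable (A' i).
    by rewrite -[X in measurable X]setTI; apply: measurable_funD.
  rewrite -(bm_rect bm n mt mA'); congr (nu _).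
  by apply/seteqP; split => w /= wA i iN; have := wA i iN; rewrite /A'/= incrE.
pose g i (x : R) : R := (if (i < k)%N then expR (c * x - c ^+ 2 * (val (t i.+1) - val (t i)) / 2) else 1)%R.
pose F i (x : R) := (g i x * \1_(A i) x)%R.
pose C i := fine (nu [set w | A i (w (t i.+1) - w (t i) + e i)%R]).
transitivity (\int[nu]_w (\prod_(i < n) F i (w (t i.+1) - w (t i))%R)%:E).
  have mg i : measurable_fun setT (g i).
    rewrite /g; case: (i < k)%N => //.
    by apply: measurableT_comp => //; apply: measurable_funB => //; exact: measurable_funM.
  have mB i : measurable [set x : R | A i (x + e i)%R].
    by rewrite -[X in measurable X]setTI; apply: measurable_funD.
  have CE i : (C i)%:E = nu [set w | A i (w (t i.+1) - w (t i) + e i)%R].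
    rewrite /C fineK// fin_num_measure//; exact: (measurable_incr_set _ _ (mB i)).
  rewrite (@integral_prod_independent _ _ _ nu n (fun i w => w (t i.+1) - w (t i))%R _ _ F C).
  - by rewrite -prodEFin; apply: eq_bigr => i _.
  - by move=> i; exact: measurable_incr.
  - by move=> B mB'; exact: (bm_rect bm n mt mB').
  - by move=> i; apply: measurable_funM => //; exact: measurable_indic.
  - by move=> i x; rewrite mulr_ge0// /g; case: (i < k)%N => //; exact: expR_ge0.
  - move=> i iN; rewrite CE /F /g /e; case: ifP => ik; first by apply: incr_tilt; first exact: mt.
    have mS : measurable [set w : W R | A i (w (t i.+1) - w (t i))%R] by exact: measurable_incr_set.
    transitivity (\int[nu]_w (\1_[set w : W R | A i (w (t i.+1) - w (t i))%R] w)%:E).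
      by apply: eq_integral => w _; rewrite mul1r !indicE; congr (((nat_of_bool _)%:R)%:E); apply/idP/idP; rewrite !inE.
    rewrite integral_indic// setIT; congr (nu _).
    by apply/seteqP; split => w /=; rewrite addr0.
rewrite [RHS]integral_mkcond; apply: eq_integral => w _.
rewrite patchE; case: ifPn => [/set_mem wA|]; last first.
  rewrite notin_setE => /existsNP [i /not_implyP [iN nA]].
  by rewrite (bigD1 (Ordinal iN))//= /F indicE memNset// mulr0 mul0r.
congr EFin; rewrite /F.
rewrite (eq_bigr (fun i : 'I_n => g i (w (t i.+1) - w (t i))%R)); last first.
  by move=> i _; rewrite indicE mem_set ?mulr1//; exact: wA.
rewrite -(big_mkord xpredT (fun i => g i (w (t i.+1) - w (t i))%R)) (big_cat_nat (leq0n k) kn)//=.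
rewrite [X in (_ * X)%R]big1_seq ?mulr1; last first.
  by move=> i /=; rewrite mem_index_iota /g => /andP[ki _]; rewrite ltnNge ki.
rewrite (eq_big_seq (fun i => expR (c * (w (t i.+1) - w (t i)) -
   c ^+ 2 * (val (t i.+1) - val (t i)) / 2))); last first.
  by move=> i; rewrite mem_index_iota /g => /andP[_ ->].
rewrite -expR_sum /girsanov_density; congr expR.
rewrite sumrB -mulr_sumr telescope_sumr// -mulr_suml -mulr_sumr telescope_sumr//.
by rewrite t0 tk /= subr0.
Qed.

End cameron_martin.

(** * Limits of measure-preserving maps *)

Section piecewise.
Context d (T : measurableType d) (R : realType).
Local Open Scope ereal_scope.

Lemma measure_piecewise_eq (m1 m2 : {measure set T -> \bar R}) (N : nat)
    (K : nat -> set T) (A B : set T) :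
  measurable A -> measurable B -> (forall i, measurable (K i)) ->
  (forall x, exists2 i, (i < N)%N & K i x) ->
  (forall i j x, (i < N)%N -> (j < N)%N -> K i x -> K j x -> i = j) ->
  (forall i, (i < N)%N -> m1 (A `&` K i) = m2 (B `&` K i)) -> m1 A = m2 B.
Proof.
move=> mA mB mK Kcov Ktriv m12.
have split_measure (m : {measure set T -> \bar R}) (C : set T) : measurable C ->
    m C = \sum_(i \in `I_N) m (C `&` K i).
  move=> mC; rewrite -measure_fin_bigcup//.
  - congr (m _); apply/seteqP; split => [x Cx|x [i _ []//]].
    by have [i iN Ki] := Kcov x; exists i.
  - by move=> i j iN jN [x [[_ Ki] [_ Kj]]]; exact: Ktriv Ki Kj.
  - by move=> i _; exact: measurableI.
rewrite (split_measure m1)// (split_measure m2)//.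
by apply: eq_fsbigr => i; rewrite inE => iN; exact: m12.
Qed.

Lemma measurable_piecewise (N : nat) (K : nat -> set T) (A : set T) :
  (forall x, exists2 i, (i < N)%N & K i x) ->
  (forall i, (i < N)%N -> measurable (A `&` K i)) -> measurable A.
Proof.
move=> Kcov mK; rewrite (_ : A = \bigcup_(i in `I_N) (A `&` K i)).
  by apply: fin_bigcup_measurable.
apply/seteqP; split => [x Ax|x [i _ []//]].
by have [i iN Ki] := Kcov x; exists i.
Qed.

End piecewise.

Section law_limit.
Context {R : realType} (nu : probability (W R) R).
Implicit Types (w : W R) (t u : time R) (s : seq (time R)).

Let ramp (k : nat) (x : R) : R := Num.min 1 (Num.max 0 (k%:R * x)).

Let ramp_ge0 k x : 0 <= ramp k x.
Proof. by rewrite /ramp le_min ler01 le_max lexx. Qed.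

Let ramp_le1 k x : ramp k x <= 1.
Proof. by rewrite /ramp ge_min lexx. Qed.

Let ramp_continuous k : continuous (ramp k).
Proof.
have c1 : continuous (fun _ : R => (1 : R)) by exact: cst_continuous.
have c0 : continuous (fun _ : R => (0 : R)) by exact: cst_continuous.
have ck : continuous (fun y : R => k%:R * y) by move=> y; apply: cvgMl_tmp; exact: cvg_id.
by move=> x; exact: (continuous_min (c1 x) (continuous_max (c0 x) (ck x))).
Qed.

Let ramp_cvg (x : R) : ramp k x @[k --> \oo] --> ((0 < x)%R%:R : R).
Proof.
have [x0|x0] := ltP 0 x; last first.
  rewrite (_ : (fun k => ramp k x) = cst 0); first exact: cvg_cst.
  apply/funext => k; rewrite /ramp max_l ?min_r ?ler01//.
  by rewrite mulr_ge0_le0.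
apply: cvg_near_cst; exists (Num.truncn x^-1).+1 => // k /= xk.
have kx : 1 <= k%:R * x.
  rewrite -ler_pdivrMr// mul1r (le_trans _ (_ : (Num.truncn x^-1).+1%:R <= _))//.
    by rewrite ltW// truncnS_gt.
  by rewrite ler_nat.
by rewrite /ramp max_r ?min_l// (le_trans ler01).
Qed.

Let soft (s : seq (time R)) (a : time R -> R) k w : R := \prod_(t <- s) ramp k (a t - w t).

Let soft_ge0 s a k w : 0 <= soft s a k w.
Proof. by apply: prodr_ge0 => t _. Qed.

Let soft_le1 s a k w : soft s a k w <= 1.
Proof. by apply: prodr_ile1 => t _; rewrite ramp_ge0 ramp_le1. Qed.

Let measurable_soft s a k : measurable_fun setT (soft s a k).
Proof.
apply: measurable_prod => t _.
have mr : measurable_fun setT (ramp k) by apply: continuous_measurable_fun.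
apply: (measurableT_comp mr); apply: measurable_funB => //; exact: measurable_eval.
Qed.

Let soft_cvg_cylinder s a w : soft s a k w @[k --> \oo] --> (\1_(cylinder s a) w : R).
Proof.
have -> : \1_(cylinder s a) w = \prod_(t <- s) ((0 < a t - w t)%R%:R : R).
  elim: s => [|t s ih]; first by rewrite big_nil cylinder_nil indicE mem_set.
  rewrite big_cons -ih cylinder_cons !indicE in_setI -mulnb natrM subr_gt0; congr (_ * _).
  by congr ((nat_of_bool _)%:R); apply/idP/idP; rewrite inE.
rewrite /soft; elim: s => [|t s ih].
  by under eq_fun do rewrite big_nil; rewrite big_nil; exact: cvg_cst.
under eq_fun do rewrite big_cons; rewrite big_cons.
by apply: cvgM; [exact: ramp_cvg|exact: ih].
Qed.

Let soft_cvg_path s a k (wn : nat -> W R) w : (forall t, wn n t @[n --> \oo] --> w t) ->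
  soft s a k (wn n) @[n --> \oo] --> soft s a k w.
Proof.
move=> wnw; rewrite /soft; elim: s => [|t s ih].
  by under eq_fun do rewrite big_nil; rewrite big_nil; exact: cvg_cst.
under eq_fun do rewrite big_cons; rewrite big_cons.
apply: cvgM; last exact: ih.
apply: (@cvg_comp _ _ _ (fun n => a t - wn n t) (ramp k)); last exact: ramp_continuous.
by apply: cvgB; [exact: cvg_cst|exact: wnw].
Qed.

Local Open Scope ereal_scope.

Lemma bounded_cvg_integral (h : nat -> W R -> R) (h' : W R -> R) :
  (forall n, measurable_fun setT (h n)) -> measurable_fun setT h' ->
  (forall n w, (0 <= h n w <= 1)%R) ->
  (forall w, h n w @[n --> \oo] --> h' w) ->
  \int[nu]_w (h n w)%:E @[n --> \oo] --> \int[nu]_w (h' w)%:E.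
Proof.
move=> mh mh' h01 hh'.
have [//|//|//| | |] := @dominated_convergence _ _ R nu setT measurableT
  (fun n w => (h n w)%:E) (fun w => (h' w)%:E) (cst 1%E).
- by move=> n; exact/measurable_EFinP.
- exact/measurable_EFinP.
- apply: aeW => w _; apply/fine_cvgP; split; first by apply: nearW.
  exact: hh'.
- exact: (finite_measure_integrable_cst nu 1).
- apply: aeW => w n _; have /andP[h0 h1] := h01 n w.
  by rewrite gee0_abs lee_fin.
by [].
Qed.

(** Pointwise convergence gives convergence of the expectations of continuous
    functions of finitely many coordinates, here the products [soft] of ramps
    which increase to the indicator of a cylinder. *)
Lemma law_limit (f_ : nat -> W R -> W R) (f : W R -> W R) :
  (forall n, measurable_fun setT (f_ n)) ->
  (forall n U, measurable U -> nu (f_ n @^-1` U) = nu U) ->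
  (forall w t, f_ n w t @[n --> \oo] --> f w t) ->
  measurable_fun setT f /\ forall U, measurable U -> nu (f @^-1` U) = nu U.
Proof.
move=> mf_ nuf_ f_f.
have mf : measurable_fun setT f.
  apply: measurable_path => t.
  apply: (@measurable_fun_cvg _ _ _ setT (fun n w => f_ n w t)) => //.
  move=> n; exact: (measurableT_comp (measurable_eval t) (mf_ n)).
split => // U mU.
pose g : {mfun W R >-> W R} := HB.pack f (isMeasurableFun.Build _ _ _ _ _ mf).
apply: (@path_measure_unique _ (distribution nu g) nu) => //.
  by rewrite (le_lt_trans (probability_le1 (distribution nu g) measurableT))// ltry.
move=> s a.
have soft_n k n : \int[nu]_w (soft s a k (f_ n w))%:E = \int[nu]_w (soft s a k w)%:E.
  pose gn : {mfun W R >-> W R} := HB.pack (f_ n) (isMeasurableFun.Build _ _ _ _ _ (mf_ n)).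
  rewrite -[RHS](@eq_measure_integral _ _ _ setT nu (distribution nu gn)); last first.
    by move=> V mV _; exact: nuf_.
  rewrite ge0_integral_pushforward//; first exact/measurable_EFinP.
  by move=> w _; rewrite lee_fin.
have soft_f k : \int[nu]_w (soft s a k (f w))%:E = \int[nu]_w (soft s a k w)%:E.
  have h := @bounded_cvg_integral (fun n w => soft s a k (f_ n w)) (fun w => soft s a k (f w)) _ _ _ _.
  have : \int[nu]_w (soft s a k (f_ n w))%:E @[n --> \oo] --> \int[nu]_w (soft s a k (f w))%:E.
    apply: h.
    - by move=> n; exact: (measurableT_comp (measurable_soft s a k) (mf_ n)).
    - exact: (measurableT_comp (measurable_soft s a k) mf).
    - by move=> n w; rewrite soft_ge0 soft_le1.
    - by move=> w; apply: soft_cvg_path => t; exact: f_f.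
  under eq_fun do rewrite soft_n.
  by move=> /cvg_lim <-//; rewrite lim_cst.
have cyl_lim (m : W R -> W R) : measurable_fun setT m ->
    \int[nu]_w (soft s a k (m w))%:E @[k --> \oo] --> nu (m @^-1` cylinder s a).
  move=> mm; have mS : measurable (m @^-1` cylinder s a).
    by rewrite -[X in measurable X]setTI; apply: mm => //; exact: measurable_cylinder.
  rewrite -[X in _ --> nu X]setIT -integral_indic//.
  apply: bounded_cvg_integral.
  - by move=> k; exact: (measurableT_comp (measurable_soft s a k) mm).
  - exact: measurable_indic.
  - by move=> k w; rewrite soft_ge0 soft_le1.
  - by move=> w; have := @soft_cvg_cylinder s a (m w); rewrite !indicE (_ : (m w \in cylinder s a) = (w \in m @^-1` cylinder s a))//; apply/idP/idP; rewrite !inE.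
have := cyl_lim f mf; under eq_fun do rewrite soft_f.
move=> f_cvg; apply: cvg_unique f_cvg _ => //.
exact: cyl_lim (@measurable_id _ _ setT).
Qed.

End law_limit.

(** * Reflection at the first zero after a given time *)

Section first_zero.
Context {R : realType}.
Implicit Types (w : W R) (s t u T : time R).

(** The first zero in [s, T], with T as default value when there is none: the
    reflected path is then unchanged up to the horizon T. *)
Definition first_zero_spec s T w : set (time R) :=
  [set z | [/\ val s <= val z <= val T,
    forall u, val s <= val u -> val u < val z -> w u <> 0,
    zeros_in (val s) (val T) w -> w z = 0 &
    ~ zeros_in (val s) (val T) w -> z = T]].

Definition first_zero s T w : time R := xget T (first_zero_spec s T w).

Lemma first_zeroP s T w : val s <= val T -> first_zero_spec s T w (first_zero s T w).
Proof.
move=> sT; rewrite /first_zero; case: xgetP => [z _ //|nz]; exfalso.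
have [[u uab wu]|nZ] := pselect (zeros_in (val s) (val T) w); last first.
  apply: (nz T); split => //; first by rewrite sT lexx.
  by move=> u su uT wu; apply: nZ; exists u => //; rewrite su ltW.
pose A := [set u : time R | val s <= val u <= val T] `&` [set u | w u = 0].
have cA : compact A.
  apply: (@subclosed_compact _ _ [set u : time R | val s <= val u <= val T]).
  - apply: closedI; last first.
      apply: (@closed_comp _ _ (w : time R -> R) [set 0]); last exact: closed_eq.
      by move=> x _; exact: (@W_continuous R w).
    have -> : [set u : time R | val s <= val u <= val T] = (val : time R -> R) @^-1` `[val s, val T]%classic.
      by apply/seteqP; split => x /=; rewrite in_itv.
    apply: closed_comp; last exact: itv_closed.
    by move=> x _; exact: val_time_continuous.
  - exact: compact_time.
  - by move=> x [].
have [|c] := compact_EVT_min _ cA (continuous_subspaceT (@val_time_continuous R)).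
  by exists u.
move=> /set_mem [/= cab wc] cmin; apply: (nz c); split => //.
- move=> x sx xc wx; have := cmin x; rewrite leNgt xc.
  case/(_ _)/negP => //; apply: mem_set; split => //=.
  by rewrite sx (le_trans (ltW xc))//; case/andP: cab.
- by case; exists u.
Qed.

Definition refl_zero s T w : W R := refl (first_zero s T w) w.

End first_zero.

Section refl_zero_law.
Context {R : realType} (nu : probability (W R) R).
Context (bm : standard_BM nu (fun w : W R => w)).
Context (s T : time R) (sT : val s <= val T).
Implicit Types (w : W R) (t u : time R).

Let delta (N : nat) : R := (val T - val s) / N.+1%:R.

Let delta_ge0 N : 0 <= delta N.
Proof. by rewrite divr_ge0// subr_ge0. Qed.

Let grid (N j : nat) : time R := to_time (val s + j%:R * delta N).

Let val_grid N j : val (grid N j) = val s + j%:R * delta N.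
Proof. by rewrite val_to_time// addr_ge0// ?time_ge0// mulr_ge0. Qed.

Let grid_le N i j : (i <= j)%N -> val (grid N i) <= val (grid N j).
Proof. by move=> ij; rewrite !val_grid lerD2l ler_wpM2r// ler_nat. Qed.

Let grid_end N : val (grid N N.+1) = val T.
Proof. by rewrite val_grid /delta mulrC divfK// addrC subrK. Qed.

Let hit N j : set (W R) := zeros_in (val s) (val (grid N j)).

Let idx N w : nat := find (fun j => `[< hit N j w >]) (iota 0 N.+1).

(** The first of the N + 2 grid points such that there is a zero between s and
    it has index j; the last index, N + 1, means that there is none up to the
    grid point N. *)
Let hit_at N j : set (W R) := [set w | (forall i, i \in iota 0 j -> (~` hit N i) w) /\
  ((j <= N)%N -> hit N j w)].

Let idx_le N w : (idx N w < N.+2)%N.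
Proof. by rewrite ltnS -[X in (_ <= X)%N](size_iota 0 N.+1) find_size. Qed.

Let hit_at_idx N w : hit_at N (idx N w) w.
Proof.
split=> [i|iN].
  rewrite mem_iota add0n => /andP[_ ii].
  have := before_find 0%N ii; rewrite nth_iota; last first.
    by rewrite (leq_trans ii)// -ltnS idx_le.
  by rewrite add0n => /asboolPn.
have hasP : has (fun j => `[< hit N j w >]) (iota 0 N.+1).
  by rewrite has_find size_iota ltnS.
by have := nth_find 0%N hasP; rewrite nth_iota ?ltnS// add0n => /asboolP.
Qed.

Let hit_at_inj N i j w : (i < N.+2)%N -> (j < N.+2)%N -> hit_at N i w -> hit_at N j w -> i = j.
Proof.
wlog ij : i j / (i <= j)%N.
  move=> wlg iN jN Ki Kj; have [ij|/ltnW ji] := leqP i j; first exact: wlg.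
  by apply/esym; exact: wlg.
move=> iN jN [Ki iZ] [Kj jZ]; apply/eqP; rewrite eqn_leq ij/= leqNgt; apply/negP => lij.
apply: (Kj i); first by rewrite mem_iota.
by apply: iZ; rewrite -ltnS (leq_trans lij)// -ltnS.
Qed.

Let measurable_hit_at N j : measurable (hit_at N j).
Proof.
apply: measurableI; last by apply: measurable_imply; exact: measurable_zeros_in.
apply: measurable_forall_seq => i _; apply: measurableC.
exact: measurable_zeros_in.
Qed.

(** The discretised first zero is a stopping time: whether it equals a grid
    point is decided before that point, hence is not affected by reflecting
    there. *)
Let hit_at_refl N j w : hit_at N j (refl (grid N j) w) <-> hit_at N j w.
Proof.
have hitE i : (i <= j)%N -> hit N i (refl (grid N j) w) <-> hit N i w.
  move=> ij; split => -[u /andP[su ui] wu]; exists u; rewrite ?su//; move: wu.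
    by rewrite refl_before// (le_trans ui)// grid_le.
  by rewrite refl_before// (le_trans ui)// grid_le.
split => -[Ki Kj]; split.
- move=> i /[dup] ij /Ki nh h; apply: nh; apply/hitE => //.
  by move: ij; rewrite mem_iota add0n => /andP[_ /ltnW].
- by move=> /Kj; rewrite hitE.
- move=> i /[dup] ij /Ki nh h; apply: nh; apply/hitE => //.
  by move: ij; rewrite mem_iota add0n => /andP[_ /ltnW].
- by move=> /Kj; rewrite hitE.
Qed.

Let refl_grid N w : W R := refl (grid N (idx N w)) w.

Let refl_grid_hit_at N j U : (j < N.+2)%N -> refl_grid N @^-1` U `&` hit_at N j = refl (grid N j) @^-1` (U `&` hit_at N j).
Proof.
move=> jN; apply/seteqP; split => w /=.
  move=> [+ Kj]; rewrite /refl_grid (hit_at_inj (idx_le N w) jN (hit_at_idx N w) Kj) => Uw.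
  by split => //; apply/hit_at_refl.
move=> [Uw /hit_at_refl Kj]; split => //.
by rewrite /refl_grid (hit_at_inj (idx_le N w) jN (hit_at_idx N w) Kj).
Qed.

Let hit_at_cov N w : exists2 i, (i < N.+2)%N & hit_at N i w.
Proof. by exists (idx N w). Qed.

Let measurable_refl_hit_at N j U : measurable U -> measurable (refl (grid N j) @^-1` (U `&` hit_at N j)).
Proof.
move=> mU; rewrite -[X in measurable X]setTI; apply: measurable_refl => //.
exact: measurableI.
Qed.

Let measurable_refl_grid N : measurable_fun setT (refl_grid N).
Proof.
move=> _ U mU; rewrite setTI; apply: (measurable_piecewise (hit_at_cov N)) => j jN.
by rewrite refl_grid_hit_at//; exact: measurable_refl_hit_at.
Qed.

(** The strong Markov argument for a stopping time with finitely many values: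
    on each piece the map is a reflection at a fixed time. *)
Let bm_refl_grid N U : measurable U -> nu (refl_grid N @^-1` U) = nu U.
Proof.
move=> mU; apply: (measure_piecewise_eq _ _ (measurable_hit_at N) (hit_at_cov N)) => //.
- by rewrite -[X in measurable X]setTI; exact: measurable_refl_grid.
- by move=> i j w; exact: hit_at_inj.
- by move=> j jN; rewrite refl_grid_hit_at//; apply: (bm_refl bm); exact: measurableI.
Qed.

Let idx_close N w : `|val (grid N (idx N w)) - val (first_zero s T w)| <= delta N.
Proof.
have [/andP[sz zT] zmin z0 zE] := first_zeroP w sT.
set z := first_zero s T w in sz zT zmin z0 zE *.
set j := idx N w; have jN : (j < N.+2)%N := idx_le N w.
have [Ki Kj] : hit_at N j w := hit_at_idx N w.
have zj : val z <= val (grid N j).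
  have [jleN|Nj] := leqP j N; last first.
    have -> : j = N.+1 by apply/eqP; rewrite eqn_leq -ltnS jN.
    by rewrite grid_end.
  have [u /andP[su uj] wu] := Kj jleN.
  by apply: le_trans uj; rewrite leNgt; apply/negP => uz; exact: zmin wu.
rewrite ger0_norm ?subr_ge0// lerBlDl.
case jE : j => [|i]; first by rewrite val_grid mul0r addr0 (le_trans sz)// lerDl.
suff iz : val (grid N i) <= val z.
  by rewrite val_grid -natr1 mulrDl mul1r addrA -val_grid lerD2r.
rewrite leNgt; apply/negP => zi.
have iT : val (grid N i) <= val T.
  by rewrite -(grid_end N) grid_le// ltnW// -ltnS -jE.
have Z : zeros_in (val s) (val T) w.
  by apply: contrapT => /zE zT'; move: zi; rewrite zT' ltNge iT.
apply: (Ki i); first by rewrite jE mem_iota add0n ltnSn.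
by exists z; [rewrite sz ltW|exact: z0].
Qed.

Let refl_grid_cvg w t : refl_grid N w t @[N --> \oo] --> refl_zero s T w t.
Proof.
have cz : grid N (idx N w) @[N --> \oo] --> first_zero s T w.
  move=> A /nbhs_val_time [e e0 eA].
  exists (Num.truncn ((val T - val s) / e)).+1 => // N /= eN; apply: eA.
  rewrite (le_lt_trans (idx_close N w))// /delta ltr_pdivrMr// mulrC -ltr_pdivrMr//.
  by rewrite (lt_le_trans (truncnS_gt _))// ler_nat leqW.
have cw : continuous (fun c : time R => w (time_min c t)).
  move=> c; apply: (@continuous_comp _ _ _ (time_min ^~ t) w); first exact: time_min_continuous.
  exact: (@W_continuous R w).
have time_minC c : time_min t c = time_min c t.
  by apply: val_inj; rewrite !val_time_min minC.
rewrite /refl_zero reflE time_minC; under eq_fun do rewrite /refl_grid reflE time_minC.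
apply: cvgB; last exact: cvg_cst.
apply: cvgMl_tmp.
exact: (cvg_comp (fun N => grid N (idx N w)) (fun c => w (time_min c t)) cz (cw (first_zero s T w))).
Qed.

Lemma measurable_refl_zero : measurable_fun setT (refl_zero s T).
Proof. by have [] := law_limit measurable_refl_grid bm_refl_grid refl_grid_cvg. Qed.

(** The grid points just after the first zero tend to it as the mesh goes to 0,
    and reflection is continuous in the time of reflection. *)
Lemma bm_refl_zero U : measurable U -> nu (refl_zero s T @^-1` U) = nu U.
Proof. by have [_] := law_limit measurable_refl_grid bm_refl_grid refl_grid_cvg; exact. Qed.

End refl_zero_law.

(** * Flipping after the last zero before a horizon *)

Section flip_after_last_zero.
Context {R : realType}.
Implicit Types (w : W R) (t u T : time R) (s : seq (time R)).

(** The value at t of the path flipped after its last zero before T, expressed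
    without that zero: it is at least t exactly when there is a zero in [t, T]. *)
Definition flip_until T w t : R :=
  if `[< zeros_in (val t) (val T) w >] then w t else - w t.

Lemma zeros_in_antitone (a b T : R) w : a <= b -> zeros_in b T w -> zeros_in a T w.
Proof. by move=> ab [u /andP[bu uT] wu]; exists u => //; rewrite (le_trans ab bu). Qed.

Lemma refl_zero_before (s T : time R) w u : val s <= val T -> val u <= val s ->
  refl_zero s T w u = w u.
Proof.
move=> sT us; have [/andP[sz _] _ _ _] := first_zeroP w sT.
by rewrite refl_before// (le_trans us).
Qed.

(** Reflection at a zero only changes signs; and if there is no zero in [s, T]
    the path is not changed up to T. *)
Lemma zeros_in_refl_zero (s T : time R) (a : R) w : val s <= val T ->
  zeros_in a (val T) (refl_zero s T w) <-> zeros_in a (val T) w.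
Proof.
move=> sT; have [/andP[sz zT] _ z0 zE] := first_zeroP w sT.
suff E u : val u <= val T -> refl_zero s T w u = 0 <-> w u = 0.
  by split => -[u /andP[au uT] /E wu]; exists u; rewrite ?au ?uT//; apply: wu.
move=> uT; have [uz|/ltW zu] := leP (val u) (val (first_zero s T w)).
  by rewrite refl_before.
have [Z|nZ] := pselect (zeros_in (val s) (val T) w); last first.
  by rewrite refl_before// (zE nZ).
rewrite /refl_zero refl_after// (z0 Z) mulr0 sub0r; split => [/eqP|->].
  by rewrite oppr_eq0 => /eqP.
by rewrite oppr0.
Qed.

Lemma measurable_flip_until T t : measurable_fun setT (fun w : W R => flip_until T w t).
Proof.
apply: measurable_fun_ifT.
- apply: (measurable_fun_bool true).
  rewrite setTI (_ : _ @^-1` _ = zeros_in (val t) (val T)).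
    exact: measurable_zeros_in.
  by apply/seteqP; split => w /= /asboolP.
- exact: measurable_eval.
- by apply: measurableT_comp => //; exact: measurable_eval.
Qed.

Definition flip_cylinder T s (a : time R -> R) : set (W R) :=
  [set w | forall t, t \in s -> flip_until T w t < a t].

Lemma measurable_flip_cylinder T s a : measurable (flip_cylinder T s a).
Proof.
apply: measurable_forall_seq => t _.
have := measurable_flip_until T t measurableT (@measurable_itv R `]-oo, a t[).
by rewrite setTI; congr (measurable _); apply/seteqP; split => w; rewrite /= in_itv.
Qed.

Context (nu : probability (W R) R).
Context (bm : standard_BM nu (fun w : W R => w)).

Definition girsanov_measure (c : R) (T : time R) : {measure set (W R) -> \bar R} :=
  density_measure nu (measurable_girsanov_density c T) (@girsanov_density_ge0 R c T).

(** The pieces [E i] say that the last zero before T lies between t_i and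
    t_(i+1).  On [E i] the flip coincides at the grid points with reflection at
    the first zero after t_i, which preserves Wiener measure and [E i], and
    changes the sign of w(T), that is, the sign of c in the density. *)
Lemma girsanov_measure_flip (c : R) (T : time R) s a :
  girsanov_measure (- c) T (flip_cylinder T s a) = girsanov_measure c T (cylinder s a).
Proof.
have [t [mt t0 ts]] := grid_through s; set n := size s in ts.
pose Z i := zeros_in (R := R) (val (t i)) (val T).
(* The index n + 1 collects the null set of paths not starting at 0. *)
pose E i : set (W R) := if (i <= n)%N then
  [set w : W R | w time0 = 0 /\ Z i w /\ ((i < n)%N -> (~` Z i.+1) w)]
  else if i == n.+1 then [set w : W R | w time0 != 0] else set0.
have Zanti i j w : (i <= j)%N -> Z j w -> Z i w.
  by move=> ij; apply: zeros_in_antitone; exact: mt.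
have mE i : measurable (E i).
  rewrite /E; case: (i <= n)%N; last first.
    by case: (i == n.+1) => //; exact: measurable_start.
  apply: measurableI.
    rewrite -[X in measurable X]setTI.
    exact: (@measurable_eval R time0 measurableT [set 0] (measurable_set1 _)).
  apply: measurableI; first exact: measurable_zeros_in.
  by apply: measurable_imply; apply: measurableC; exact: measurable_zeros_in.
have Ecov w : exists2 i, (i < n.+2)%N & E i w.
  have [w0|w0] := eqVneq (w time0) 0; last first.
    by exists n.+1 => //; rewrite /E ltnn eqxx.
  have exZ : exists i, (i <= n)%N && `[< Z i w >].
    exists 0%N => /=; apply/asboolP; exists time0 => //.
    by rewrite t0 lexx/= time_ge0.
  have ub i : (i <= n)%N && `[< Z i w >] -> (i <= n)%N by case/andP.
  case: (ex_maxnP exZ ub) => i /andP[iN /asboolP Zi] imax.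
  exists i; first by rewrite ltnS leqW.
  rewrite /E iN; split => //; split => // lin Zi1.
  by have := imax i.+1; rewrite lin ltnn => /(_ (asboolT Zi1)).
have Einj i j w : (i < n.+2)%N -> (j < n.+2)%N -> E i w -> E j w -> i = j.
  wlog ij : i j / (i < j)%N.
    move=> wlg iN jN Ei Ej; have [ij|ji|//] := ltngtP i j; first exact: wlg.
    by apply/esym; exact: wlg.
  move=> iN jN; rewrite /E; have [lin|] := leqP i n; last first.
    by move=> ni; move: jN; rewrite ltnS leqNgt (leq_ltn_trans ni ij).
  move=> [w0 [Zi nZ]]; have [ljn|nj] := leqP j n; last first.
    by case: eqP => // _ /=; rewrite w0 eqxx.
  move=> [_ [Zj _]]; exfalso; apply: nZ (Zanti _ _ _ ij Zj).
  exact: leq_trans ij ljn.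
apply: (measure_piecewise_eq (measurable_flip_cylinder T s a) (measurable_cylinder s a) mE Ecov Einj).
move=> i iN.
have null (b : R) (U : set (W R)) : measurable U -> density_measure nu (measurable_girsanov_density b T)
    (@girsanov_density_ge0 R b T) (U `&` [set w : W R | w time0 != 0]) = 0%E.
  move=> mU; apply: null_set_integral.
  - by apply: measurableI => //; exact: measurable_start.
  - apply: measurable_funTS; apply/measurable_EFinP; exact: measurable_girsanov_density.
  - apply: (@subset_measure0 _ _ _ nu _ [set w : W R | w time0 != 0]).
    + by apply: measurableI => //; exact: measurable_start.
    + exact: measurable_start.
    + by move=> w [].
    + exact: bm_start.
have [lin|ni] := leqP i n; last first.
  have iE : i = n.+1 by apply/eqP; rewrite eqn_leq -ltnS iN.
  rewrite /E leqNgt ni/= iE eqxx.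
  by rewrite [LHS]null ?[RHS]null//; [exact: measurable_cylinder|exact: measurable_flip_cylinder].
have [tT|Tt] := leP (val (t i)) (val T); last first.
  have E0 : E i = set0.
    rewrite /E lin; apply/seteqP; split => // w [_ [[u /andP[tu uT] _] _]].
    by move: Tt; rewrite ltNge (le_trans tu uT).
  by rewrite E0 !setI0 !measure0.
have start w : refl_zero (t i) T w time0 = w time0.
  by apply: refl_zero_before; rewrite ?time_ge0.
have ZR j w : Z j (refl_zero (t i) T w) <-> Z j w by exact: zeros_in_refl_zero.
have RE w : E i (refl_zero (t i) T w) <-> E i w.
  rewrite /E lin /= start; split => -[w0 [/ZR Zi nZ]].
    by split => //; split => // /nZ nZi /ZR.
  by split => //; split => // /nZ nZi /ZR.
have flipE w u : E i w -> u \in s -> refl_zero (t i) T w u = flip_until T w u.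
  rewrite /E lin => -[w0 [Zi nZ]] /ts [k kn <-].
  rewrite /flip_until; have [ki|ik] := leqP k i.
    by rewrite asboolT ?refl_zero_before//; [exact: mt|exact: Zanti Zi].
  have nZi := nZ (leq_trans ik kn).
  rewrite asboolF; last by move=> Zk; apply: nZi; exact: Zanti Zk.
  have [/andP[tz zT] _ z0 _] := first_zeroP w tT.
  rewrite /refl_zero refl_after ?(z0 Zi) ?mulr0 ?sub0r//.
  rewrite leNgt; apply/negP => kz; apply: nZi; exists (first_zero (t i) T w); last exact: z0.
  by rewrite zT andbT (le_trans (mt _ _ ik))// ltW.
have preim : flip_cylinder T s a `&` E i = refl_zero (t i) T @^-1` (cylinder s a `&` E i).
  apply/seteqP; split => w [wC].
    move=> Ei; split; last exact/RE.
    by move=> u us; rewrite /= flipE//; exact: wC.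
  move=> /RE Ei; split => //.
  by move=> u us; rewrite -flipE//; exact: wC.
have dens w : E i w -> girsanov_density (- c) T w = girsanov_density c T (refl_zero (t i) T w).
  rewrite /E lin => -[w0 [Zi nZ]]; rewrite /girsanov_density start w0.
  have [/andP[tz zT] _ z0 _] := first_zeroP w tT.
  by rewrite /refl_zero refl_after// (z0 Zi) mulr0 sub0r !subr0 sqrrN mulNr mulrN.
have mR := measurable_refl_zero bm tT.
pose r : {mfun W R >-> W R} := HB.pack (refl_zero (t i) T) (isMeasurableFun.Build _ _ _ _ _ mR).
have mCE : measurable (cylinder s a `&` E i) by apply: measurableI => //; exact: measurable_cylinder.
have md : measurable_fun setT (fun w : W R => (girsanov_density c T w)%:E).
  by apply/measurable_EFinP; exact: measurable_girsanov_density.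
rewrite preim; transitivity (\int[distribution nu r]_(w in cylinder s a `&` E i) (girsanov_density c T w)%:E)%E.
  rewrite ge0_integral_pushforward; last 3 first.
  - exact: mCE.
  - exact: measurable_funTS md.
  - by move=> w _; rewrite lee_fin girsanov_density_ge0.
  apply: eq_integral => w /set_mem [_ /RE Ei].
  - by rewrite /= dens.
  - exact: mR.
rewrite (eq_measure_integral nu)// => U mU _.
exact: (bm_refl_zero bm tT mU).
Qed.

End flip_after_last_zero.

(** * The reflected path *)

Section reflected_path.
Context {R : realType}.
Implicit Types (w : W R) (t u : time R) (s : seq (time R)).

Definition zero_after w t := exists2 u, val t <= val u & w u = 0.

Definition flip w t : R := if `[< zero_after w t >] then w t else - w t.

Lemma add_driftE c w t : add_drift c w t = w t + c * val t.
Proof. by []. Qed.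

(** The set of visits is closed, so a finite last visit is attained. *)
Lemma last_visitP theta w t : ((val t)%:E <= last_visit theta w)%E <->
  zero_after (add_drift (- (2^-1 * theta)) w) t.
Proof.
have zE u : add_drift (- (2^-1 * theta)) w u = 0 <-> w u = 2^-1 * theta * val u.
  rewrite add_driftE mulNr; split => [/eqP|->]; last by rewrite subrr.
  by rewrite subr_eq0 => /eqP.
split=> [tL|[u tu /zE wu]]; last first.
  apply: (@le_trans _ _ (val u)%:E); first by rewrite lee_fin.
  by apply: ereal_sup_ubound; exists u.
apply: contrapT => nz.
have vt : add_drift (- (2^-1 * theta)) w t != 0.
  by apply/eqP => wt; apply: nz; exists t.
have [d d0 dv] : exists2 d : R, 0 < d & forall x : time R, `|val x - val t| < d ->
    add_drift (- (2^-1 * theta)) w x != 0.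
  apply: nbhs_val_time; exact: cvgr_neq0 (@W_continuous R (add_drift (- (2^-1 * theta)) w) t) vt.
suff : (last_visit theta w <= (val t - d)%:E)%E.
  by move=> /(le_trans tL); rewrite lee_fin lerBrDr gerDl leNgt d0.
apply: ge_ereal_sup => _ [u /= /zE wu <-]; rewrite lee_fin leNgt; apply/negP => du.
have [tu|ut] := leP (val t) (val u); first by apply: nz; exists u.
suff /dv : `|val u - val t| < d by rewrite wu eqxx.
by rewrite distrC gtr0_norm ?subr_gt0// ltrBlDr -ltrBlDl.
Qed.

Lemma HmapE theta w t : Hmap theta w t =
  if ((val t)%:E <= last_visit theta w)%E then w t else theta * val t - w t.
Proof. by []. Qed.

Lemma Hmap_flip theta w t :
  add_drift (- (2^-1 * theta)) (Hmap theta w) t = flip (add_drift (- (2^-1 * theta)) w) t.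
Proof.
rewrite /flip !add_driftE HmapE.
have [tL|tL] := boolP (_ <= _)%E.
  by rewrite asboolT//; apply/last_visitP.
rewrite asboolF; last by move=> /last_visitP; apply/negP.
by field.
Qed.

Lemma flip_until_cvg w t : \forall n \near \oo, flip_until (to_time n%:R) w t = flip w t.
Proof.
have [[u tu wu]|nz] := pselect (zero_after w t).
  exists (Num.truncn (val u)).+1 => // n /= un.
  rewrite /flip /flip_until !asboolT//; first by exists u.
  exists u => //; apply/andP; split => //.
  by rewrite val_to_time// (le_trans (ltW (truncnS_gt _)))// ler_nat.
apply: nearW => n; rewrite /flip /flip_until !asboolF//.
by move=> [u /andP[tu _] wu]; apply: nz; exists u.
Qed.

Lemma measurable_flip t : measurable_fun setT (fun w : W R => flip w t).
Proof.
apply: (@measurable_fun_cvg _ _ _ setT (fun n w => flip_until (to_time n%:R) w t)).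
  by move=> n; exact: measurable_flip_until.
by move=> w _; apply: cvg_near_cst; exact: flip_until_cvg.
Qed.

Lemma measurable_Hmap theta : measurable_fun setT (Hmap theta : W R -> W R).
Proof.
apply: measurable_path => t.
apply: (@eq_measurable_fun _ _ _ R setT (fun w : W R =>
    flip (add_drift (- (2^-1 * theta)) w) t + 2^-1 * theta * val t)).
  by move=> w _; rewrite -Hmap_flip add_driftE; ring.
apply: measurable_funD => //.
exact: (measurableT_comp (measurable_flip t) (measurable_add_drift _)).
Qed.

End reflected_path.

Section reflected_law.
Context {R : realType} (nu : probability (W R) R).
Context (bm : standard_BM nu (fun w : W R => w)).
Implicit Types (w : W R) (t u : time R) (s : seq (time R)).

(** Both events only depend on the path up to T, where a drift stopped at T
    agrees with a drift, so that the Girsanov formula applies. *)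
Lemma flip_until_law (c : R) (T : time R) s a : (forall t, t \in s -> val t <= val T) ->
  nu (add_drift (- c) @^-1` flip_cylinder T s a) = nu (add_drift c @^-1` cylinder s a).
Proof.
move=> sT.
have driftE b w t : val t <= val T -> drift_until b T w t = add_drift b w t.
  by move=> tT; rewrite drift_untilE min_l.
have -> : add_drift c @^-1` cylinder s a = drift_until c T @^-1` cylinder s a.
  apply/seteqP; split => w wC t ts; have := wC t ts; rewrite driftE//; exact: sT.
have -> : add_drift (- c) @^-1` flip_cylinder T s a = drift_until (- c) T @^-1` flip_cylinder T s a.
  have fE w t : t \in s -> flip_until T (add_drift (- c) w) t = flip_until T (drift_until (- c) T w) t.
    move=> ts; rewrite /flip_until driftE ?sT//; congr (if _ then _ else _).
    apply/asboolP/asboolP => -[u /andP[tu uT] wu]; exists u; rewrite ?tu//.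
      by rewrite driftE.
    by rewrite -driftE.
  by apply/seteqP; split => w wC t ts; have := wC t ts; rewrite fE.
rewrite (girsanov bm (- c) T (measurable_flip_cylinder T s a)).
rewrite (girsanov bm c T (measurable_cylinder s a)).
exact: (girsanov_measure_flip bm).
Qed.

(** The limit T -> oo of [flip_until_law]: on each path the event with horizon
    n eventually agrees with the event without horizon. *)
Lemma Hmap_law theta U : measurable U ->
  nu ((fun w => add_drift (- (2^-1 * theta)) (Hmap theta w)) @^-1` U) =
  nu (add_drift (2^-1 * theta) @^-1` U).
Proof.
set c := 2^-1 * theta.
have mf : measurable_fun setT (fun w : W R => add_drift (- c) (Hmap theta w)).
  exact: (measurableT_comp (measurable_add_drift (- c)) (measurable_Hmap theta)).
pose f : {mfun W R >-> W R} := HB.pack (fun w : W R => add_drift (- c) (Hmap theta w))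
  (isMeasurableFun.Build _ _ _ _ _ mf).
pose g : {mfun W R >-> W R} := HB.pack (add_drift c : W R -> W R)
  (isMeasurableFun.Build _ _ _ _ _ (measurable_add_drift c)).
move=> mU; apply: (@path_measure_unique _ (distribution nu f) (distribution nu g)) => //.
  by rewrite (le_lt_trans (probability_le1 (distribution nu f) measurableT))// ltry.
move=> s a.
pose A n := add_drift (- c) @^-1` flip_cylinder (to_time n%:R) s a.
pose A' := f @^-1` cylinder s a.
have mA n : measurable (A n).
  rewrite -[X in measurable X]setTI; apply: measurable_add_drift => //.
  exact: measurable_flip_cylinder.
have mA' : measurable A'.
  by rewrite -[X in measurable X]setTI; exact: (mf measurableT _ (measurable_cylinder s a)).
have near_s (s' : seq (time R)) (P : time R -> nat -> Prop) : (forall t, \forall n \near \oo, P t n) ->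
    \forall n \near \oo, forall t, t \in s' -> P t n.
  move=> Pn; elim: s' => [|t s1 ih]; first by apply: nearW.
  apply: filterS2 (Pn t) ih => n Pt Ps u; rewrite inE => /predU1P[->//|]; exact: Ps.
have A_cvg w : (\1_(A n) w : R) @[n --> \oo] --> (\1_A' w : R).
  apply: cvg_near_cst.
  have /(near_s s) := flip_until_cvg (add_drift (- c) w).
  apply: filterS => n fE; rewrite !indicE; congr ((nat_of_bool _)%:R).
  apply/idP/idP; rewrite !inE => wA t ts; have := wA t ts; rewrite /= Hmap_flip fE//.
have : (\int[nu]_w (\1_(A n) w)%:E)%E @[n --> \oo] --> (\int[nu]_w (\1_A' w)%:E)%E.
  apply: (bounded_cvg_integral _ _ _ A_cvg).
  - by move=> n; exact: measurable_indic.
  - exact: measurable_indic.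
  - by move=> n w; rewrite indicE ler0n lern1 leq_b1.
rewrite integral_indic// setIT.
under eq_fun do rewrite integral_indic// setIT.
move=> lim1.
have lim2 : nu (A n) @[n --> \oo] --> nu (g @^-1` cylinder s a).
  apply: cvg_near_cst.
  have : \forall n \near \oo, forall t, t \in s -> val t <= val (to_time n%:R).
    apply: near_s => t; exists (Num.truncn (val t)).+1 => // n tn.
    by rewrite val_to_time// (le_trans (ltW (truncnS_gt _)))// ler_nat; exact: tn.
  by apply: filterS => n sn; exact: flip_until_law.
exact: cvg_unique lim1 lim2.
Qed.

End reflected_law.

(** * The law of the last zero *)

Section gaussian_intervals.
Context {R : realType}.
Local Open Scope ereal_scope.

Lemma normal_prob_itv_cvg (x : R) (x_ : nat -> R) :
  nonincreasing_seq x_ -> (forall n, (x < x_ n)%R) -> x_ n @[n --> \oo] --> x ->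
  normal_prob 0 1 `](- x_ n)%R, (x_ n)]%classic @[n --> \oo] --> normal_prob 0 1 `[(- x)%R, x]%classic.
Proof.
move=> nx xx xcvg.
have -> : `[(- x)%R, x]%classic = \bigcap_n `](- x_ n)%R, (x_ n)]%classic.
  apply/seteqP; split => [y /=|y yn].
    rewrite in_itv/= => /andP[xy yx] n _; rewrite /= in_itv/=.
    by rewrite (lt_le_trans _ xy) ?ltrN2// (le_trans yx)// ltW.
  have yabs : (`|y| <= x)%R.
    rewrite -(cvg_lim _ xcvg)//; apply: limr_ge; first by apply/cvg_ex; exists x.
    apply: nearW => n; have := yn n I; rewrite /= in_itv/= => /andP[ny yx].
    by rewrite ler_norml (ltW ny).
  by rewrite /= in_itv/= -ler_norml.
apply: nonincreasing_cvg_mu => //.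
- by rewrite (le_lt_trans (probability_le1 _ _))// ltry.
- exact: bigcapT_measurable.
- move=> m n mn; apply/subsetPset => y /=; rewrite !in_itv/= => /andP[xy yx].
  by rewrite (le_lt_trans _ xy) ?lerN2 ?nx// (le_trans yx)// nx.
Qed.

Lemma normal_prob_set1 (x : R) : normal_prob 0 1 [set x] = 0.
Proof.
have := @normal_prob_dominates R 0 1.
move=> /null_content_dominatesP; apply => //.
exact: lebesgue_measure_set1.
Qed.

Lemma normal_prob_tail_cvg : normal_prob 0 1 `]n%:R, +oo[%classic @[n --> \oo] --> (0 : \bar R).
Proof.
rewrite -(measure0 (normal_prob (0:R) 1)).
have -> : set0 = \bigcap_n `](n%:R : R), +oo[%classic.
  apply/seteqP; split => // y /(_ (Num.truncn y).+1 I) /=.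
  by rewrite in_itv/= andbT ltNge (ltW (truncnS_gt _)).
apply: nonincreasing_cvg_mu => //.
- by rewrite (le_lt_trans (probability_le1 _ _))// ltry.
- exact: bigcapT_measurable.
- move=> m n mn; apply/subsetPset => y /=; rewrite !in_itv/= !andbT.
  by apply: le_lt_trans; rewrite ler_nat.
Qed.

End gaussian_intervals.

Section last_zero_law.
Context {R : realType} (nu : probability (W R) R).
Context (bm : standard_BM nu (fun w : W R => w)).
Implicit Types (w : W R) (t u : time R) (s : seq (time R)).
Local Open Scope ereal_scope.

Definition no_zero_after (c : R) t : set (W R) :=
  [set w | ~ zero_after (add_drift (- c) w) t].

Lemma measurable_no_zero_after c t : measurable (no_zero_after c t).
Proof.
suff : measurable [set w : W R | zero_after (add_drift (- c) w) t].
  exact: measurableC.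
rewrite (_ : [set w : W R | _] = \bigcup_n (add_drift (- c) @^-1` zeros_in (val t) n%:R)).
  apply: bigcupT_measurable => n; rewrite -[X in measurable X]setTI.
  by apply: measurable_add_drift => //; exact: measurable_zeros_in.
apply/seteqP; split => [w [u tu wu]|w [n _ [u /andP[tu _] wu]]]; last by exists u.
exists (Num.truncn (val u)).+1 => //; exists u => //.
by rewrite tu/= ltW// truncnS_gt.
Qed.

Lemma bm_eq_from_start (A B : set (W R)) : measurable A -> measurable B ->
  (forall w, w time0 = 0%R -> A w <-> B w) -> nu A = nu B.
Proof.
move=> mA mB AB.
have le (X Y : set (W R)) : measurable X -> measurable Y ->
    (forall w, w time0 = 0%R -> X w -> Y w) -> nu X <= nu Y.
  move=> mX mY XY.
  apply: (@le_trans _ _ (nu (Y `|` [set w | w time0 != 0%R]))).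
    apply: le_measure; rewrite ?inE//; first by apply: measurableU => //; exact: measurable_start.
    by move=> w Xw; have [w0|w0] := eqVneq (w time0) 0%R; [left; exact: XY|right].
  apply: le_trans; first by apply: measureU2 => //; exact: measurable_start.
  by rewrite [X in _ + X](bm_start bm) adde0.
by apply/eqP; rewrite eq_le !le// => w w0 /(AB w w0).
Qed.

Lemma bm_marginal t (A : set R) : (0 < val t)%R -> measurable A ->
  nu [set w | A (w t)] = normal_prob 0 1 ((fun z => Num.sqrt (val t) * z)%R @^-1` A).
Proof.
move=> t0 mA; have t0' : (val (time0 : time R) < val t)%R by [].
transitivity (nu [set w | A (w t - w time0)%R]).
  apply: bm_eq_from_start.
  - by rewrite -[X in measurable X]setTI; exact: (measurable_eval t measurableT mA).
  - exact: measurable_incr_set.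
  - by move=> w w0; rewrite /= w0 subr0.
rewrite (bm_increment_law bm t0' mA) -(normal_prob_affine 0)//; last by rewrite sqrtr_gt0 subr_gt0.
by congr (normal_prob 0 1); apply/seteqP; split => z; rewrite /= subr0 addr0.
Qed.

(** The intermediate value theorem. *)
Lemma path_same_sign_after w t u : ~ zero_after w t -> (val t <= val u)%R ->
  (0 < w t * w u)%R.
Proof.
move=> nz tu; rewrite ltNge; apply/negP => wtu.
have cw : {within `[val t, val u], continuous (fun r : R => w (to_time r))}.
  apply: continuous_subspaceT => r.
  apply: (@continuous_comp _ _ _ to_time w); first exact: to_time_continuous.
  exact: (@W_continuous R w).
have [|r] := @IVT R (fun r => w (to_time r)) (val t) (val u) 0%R tu cw.
  have wt0 : w t != 0%R by apply/eqP => wt; apply: nz; exists t.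
  have wu0 : w u != 0%R by apply/eqP => wu; apply: nz; exists u.
  rewrite !to_timeK ge_min le_max.
  case: (ltgtP (w t) 0%R) wt0 => // wt _; case: (ltgtP (w u) 0%R) wu0 => // wu _.
    by move: wtu; rewrite leNgt nmulr_rgt0// wu.
  by move: wtu; rewrite leNgt mulr_gt0.
rewrite in_itv/= => /andP[tr ru] wr; apply: nz; exists (to_time r) => //.
by rewrite val_to_time// (le_trans (time_ge0 t)).
Qed.

Lemma path_pos_after w t u : ~ zero_after w t -> (0 < w t)%R ->
  (val t <= val u)%R -> (0 < w u)%R.
Proof. by move=> nz wt tu; have := path_same_sign_after nz tu; rewrite pmulr_rgt0. Qed.

Lemma measurable_positive_at c t : measurable [set w : W R | (0 < add_drift c w t)%R].
Proof.
have mpos : measurable [set x : R | (0 < x)%R].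
  rewrite (_ : mkset _ = `]0%R, +oo[%classic); first exact: measurable_itv.
  by apply/seteqP; split => x /=; rewrite in_itv/= andbT.
rewrite -[X in measurable X]setTI.
exact: (measurableT_comp (measurable_eval t) (measurable_add_drift c) measurableT mpos).
Qed.

(** A path that is positive at t without later zeros remains above the line of
    slope c; at the time u = (n / c)^2 this has the probability that a standard
    Gaussian exceeds c u / sqrt u = n. *)
Lemma positive_exit_null (c : R) t : (0 < c)%R ->
  nu (no_zero_after c t `&` [set w | (0 < add_drift (- c) w t)%R]) = 0.
Proof.
move=> c0; apply/eqP; rewrite eq_le measure_ge0 andbT.
apply: (cvge_to_ge (@normal_prob_tail_cvg R)).
exists (Num.truncn (c * val t + c + 1)).+1 => // n /= nN.
have nt : (c * val t + c + 1 <= n%:R)%R.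
  by rewrite (le_trans (ltW (truncnS_gt _)))// ler_nat.
have n1 : (1 <= n%:R :> R)%R.
  by rewrite (le_trans _ nt)// lerDr addr_ge0 ?(ltW c0)// mulr_ge0 ?(ltW c0)// time_ge0.
have n0 : (0 < n%:R :> R)%R by rewrite (lt_le_trans ltr01).
have [u uE] : exists u : time R, val u = ((n%:R / c) ^+ 2)%R.
  by exists (to_time ((n%:R / c) ^+ 2)); rewrite val_to_time// sqr_ge0.
have u0 : (0 < val u)%R by rewrite uE exprn_gt0// divr_gt0.
have nc1 : (1 <= n%:R / c)%R.
  rewrite ler_pdivlMr// mul1r (le_trans _ nt)// addrAC lerDr addr_ge0// mulr_ge0 ?time_ge0//.
  exact: ltW.
have tu : (val t <= val u)%R.
  apply: (@le_trans _ _ (n%:R / c)%R); last by rewrite uE expr2 ler_peMl// (le_trans ler01).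
  rewrite ler_pdivlMr// mulrC (le_trans _ nt)// -addrA lerDl addr_ge0// ltW//.
have mu : measurable [set x : R | (c * val u < x)%R].
  rewrite (_ : mkset _ = `](c * val u)%R, +oo[%classic); first exact: measurable_itv.
  by apply/seteqP; split => x /=; rewrite in_itv/= andbT.
apply: (@le_trans _ _ (nu [set w | (c * val u < w u)%R])).
  apply: le_measure; rewrite ?inE.
  - apply: measurableI; first exact: measurable_no_zero_after.
    exact: measurable_positive_at.
  - by rewrite -[X in measurable X]setTI; exact: (measurable_eval u measurableT mu).
  - move=> w [/= nz Xt]; have := path_pos_after nz Xt tu.
    by rewrite add_driftE mulNr subr_gt0.
have cuE : (c * (n%:R / c) ^+ 2 = n%:R / c * n%:R)%R by field; rewrite gt_eqF.
rewrite (bm_marginal u0 mu) (_ : _ @^-1` _ = `]n%:R, +oo[%classic)//.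
apply/seteqP; split => z /=; rewrite in_itv/= andbT uE sqrtr_sqr gtr0_norm ?divr_gt0//.
  by rewrite cuE ltr_pM2l// divr_gt0.
by rewrite cuE ltr_pM2l// divr_gt0.
Qed.

(** Compare the events that X and the flipped path are positive at t.  They
    agree on paths with a zero after t; the remaining paths are almost surely
    negative at t, hence flipped to positive values.  The difference of the
    two probabilities is known from [Hmap_law]. *)
Lemma no_zero_after_law (c : R) t : (0 < c)%R -> (0 < val t)%R ->
  nu (no_zero_after c t) =
  normal_prob 0 1 `](- (c * Num.sqrt (val t)))%R, (c * Num.sqrt (val t))%R]%classic.
Proof.
move=> c0 t0; pose L := no_zero_after c t.
pose r := Num.sqrt (val t).
have r0 : (0 < r)%R by rewrite sqrtr_gt0.
have r2 : (r * r = val t)%R by rewrite -expr2 sqr_sqrtr// ltW.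
have mgt (b : R) : measurable [set x : R | (b < x)%R].
  rewrite (_ : mkset _ = `]b, +oo[%classic); first exact: measurable_itv.
  by apply/seteqP; split => x /=; rewrite in_itv/= andbT.
have mevgt (b : R) : measurable [set w : W R | (b < w t)%R].
  by rewrite -[X in measurable X]setTI; exact: (measurable_eval t measurableT (mgt b)).
have tail (b : R) : nu [set w | (b * val t < w t)%R] = normal_prob 0 1 `](b * r)%R, +oo[%classic.
  rewrite (bm_marginal t0 (mgt _)); congr (normal_prob 0 1).
  apply/seteqP; split => z /=; rewrite in_itv/= andbT -/r -r2 mulrA [(r * z)%R]mulrC ltr_pM2r//.
have mL : measurable L := measurable_no_zero_after c t.
pose pos := [set w : W R | (c * val t < w t)%R].
pose fpos := [set w : W R | (0 < flip (add_drift (- c) w) t)%R].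
have posE w : pos w <-> (0 < add_drift (- c) w t)%R.
  by rewrite /pos/= add_driftE mulNr subr_gt0.
have mpos : measurable pos by exact: mevgt.
have mfpos : measurable fpos.
  rewrite -[X in measurable X]setTI.
  exact: (measurableT_comp (measurable_flip t) (measurable_add_drift (- c)) measurableT (mgt 0%R)).
have fposE : nu fpos = nu [set w | ((- c) * val t < w t)%R].
  have := @Hmap_law R nu bm (2 * c) [set w | (0 < w t)%R] (mevgt 0%R).
  rewrite mulKf ?pnatr_eq0// => h.
  rewrite (_ : fpos = (fun w => add_drift (- c) (Hmap (2 * c) w)) @^-1` [set w | (0 < w t)%R]).
    rewrite h; congr (nu _); apply/seteqP; split => w /=; by rewrite add_driftE mulNr -ltrBlDr sub0r.
  have E w : add_drift (- c) (Hmap (2 * c) w) t = flip (add_drift (- c) w) t.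
    by have := Hmap_flip (2 * c) w t; rewrite mulKf ?pnatr_eq0.
  by apply/seteqP; split => w /=; rewrite E.
have Lpos0 : nu (L `&` pos) = 0.
  rewrite -[RHS](positive_exit_null t c0); congr (nu (_ `&` _)).
  by apply/seteqP; split => w /posE.
have L_fpos : nu (fpos `&` L) = nu L.
  rewrite [RHS](measureDI _ mL mpos) -/L [X in _ + X](_ : _ = 0) ?adde0//.
  congr (nu _); apply/seteqP; split => w [].
    rewrite /fpos/= /flip => + nz; rewrite asboolF// oppr_gt0 => Xw; split => // /posE.
    by rewrite ltNge (ltW Xw).
  move=> nz npos; split => //; rewrite /fpos/= /flip asboolF// oppr_gt0 lt_neqAle.
  apply/andP; split; last by rewrite leNgt; apply/negP => /posE.
  by apply/eqP => Xw; apply: nz; exists t.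
have notL : nu (fpos `\` L) = nu (pos `\` L).
  congr (nu _); apply/seteqP; split => w [+ nL]; have := contrapT nL => Z.
    by rewrite /fpos/= /flip asboolT// => Xw; split => //; apply/posE.
  by move=> /posE Xw; split => //; rewrite /fpos/= /flip asboolT.
have key : normal_prob 0 1 `](- (c * r))%R, +oo[%classic =
    nu L + normal_prob 0 1 `](c * r)%R, +oo[%classic.
  rewrite -mulNr -tail -tail -fposE -/pos.
  have -> : nu fpos = nu (fpos `\` L) + nu (fpos `&` L) by exact: measureDI.
  have -> : nu pos = nu (pos `\` L) + nu (pos `&` L) by exact: measureDI.
  rewrite L_fpos notL.
  by rewrite [pos `&` L]setIC Lpos0 adde0 addeC.
have : normal_prob 0 1 `](- (c * r))%R, +oo[%classic =
    normal_prob 0 1 `](- (c * r))%R, (c * r)%R]%classic + normal_prob 0 1 `](c * r)%R, +oo[%classic.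
  rewrite -measureU//.
  - congr (normal_prob 0 1 _); apply/seteqP; split => x /=; rewrite !in_itv/= !andbT.
      by move=> xr; have [xr'|xr'] := leP x (c * r)%R; [left; rewrite xr|right].
    by move=> [/andP[]//|]; apply: lt_trans; rewrite gtrN// mulr_gt0.
  - apply/seteqP; split => // x [] /=; rewrite !in_itv/= andbT => /andP[_ xr].
    by rewrite ltNge xr.
rewrite key => /(congr1 (fun x => x - normal_prob 0 1 `](c * r)%R, +oo[%classic)).
by rewrite !addeK// fin_num_measure.
Qed.

(** Symmetry of Brownian motion; reflecting at time 0 is negation. *)
Lemma no_zero_afterN (c : R) t : nu (no_zero_after (- c) t) = nu (no_zero_after c t).
Proof.
rewrite -(bm_refl bm time0); last exact: measurable_no_zero_after.
apply: bm_eq_from_start.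
- rewrite -[X in measurable X]setTI; apply: measurable_refl => //; exact: measurable_no_zero_after.
- exact: measurable_no_zero_after.
move=> w w0.
have E u : add_drift (- - c) (refl time0 w) u = (- add_drift (- c) w u)%R.
  by rewrite !add_driftE refl_after ?time_ge0// w0; ring.
have zE : zero_after (add_drift (- - c) (refl time0 w)) t <-> zero_after (add_drift (- c) w) t.
  split => -[u tu]; rewrite ?E => wu; exists u => //; rewrite ?E ?wu ?oppr0//.
  by apply/eqP; rewrite -oppr_eq0 wu.
by split => h /zE.
Qed.

(** A path that is positive after t never meets there a line of negative slope,
    and a negative one never meets a line of positive slope.  Both events have
    a probability that vanishes as the slope tends to 0. *)
Lemma no_zero_after0 t : (0 < val t)%R -> nu (no_zero_after 0 t) = 0.
Proof.
move=> t0; pose r := Num.sqrt (val t).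
have r0 : (0 < r)%R by rewrite sqrtr_gt0.
pose c (n : nat) : R := (n.+1%:R^-1)%R.
have c0 n : (0 < c n)%R by rewrite invr_gt0.
have bound n : nu (no_zero_after 0 t) <=
    normal_prob 0 1 `](- (c n * r))%R, (c n * r)%R]%classic +
    normal_prob 0 1 `](- (c n * r))%R, (c n * r)%R]%classic.
  have Nc : nu (no_zero_after (- c n) t) =
      normal_prob 0 1 `](- (c n * r))%R, (c n * r)%R]%classic.
    by rewrite no_zero_afterN no_zero_after_law.
  rewrite -{1}Nc -(no_zero_after_law (c0 n) t0).
  apply: (@le_trans _ _ (nu (no_zero_after (- c n) t `|` no_zero_after (c n) t))); last first.
    by apply: measureU2; exact: measurable_no_zero_after.
  apply: le_measure; rewrite ?inE; [exact: measurable_no_zero_after| |].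
    by apply: measurableU; exact: measurable_no_zero_after.
  move=> w /= nz.
  have E u : add_drift (- 0) w u = w u by rewrite add_driftE oppr0 mul0r addr0.
  have {E}nz : ~ zero_after w t.
    by move=> [u tu wu]; apply: nz; exists u; rewrite ?E.
  have drift_pos u : (val t <= val u)%R -> (0 < c n * val u)%R.
    by move=> tu; rewrite mulr_gt0// (lt_le_trans t0).
  have [wt|wt] := ltP 0%R (w t); [left|right] => -[u tu]; rewrite add_driftE => wu.
    have := addr_gt0 (path_pos_after nz wt tu) (drift_pos u tu).
    by rewrite opprK in wu; rewrite wu ltxx.
  have wtu := path_same_sign_after nz tu.
  have wt0 : (w t < 0)%R.
    by rewrite lt_neqAle wt andbT; apply/eqP => wt0; move: wtu; rewrite wt0 mul0r ltxx.
  have wu0 : (w u < 0)%R by rewrite -(nmulr_rgt0 _ wt0).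
  move: wu; rewrite mulNr => /eqP; rewrite subr_eq0 => /eqP wE.
  by move: wu0; rewrite wE ltNge (ltW (drift_pos u tu)).
apply/eqP; rewrite eq_le measure_ge0 andbT.
have lim0 : normal_prob 0 1 `](- (c n * r))%R, (c n * r)%R]%classic @[n --> \oo] --> (0 : \bar R).
  rewrite -(@normal_prob_set1 R 0) (_ : [set 0%R] = `[(- 0)%R, 0%R]%classic); last first.
    by rewrite oppr0 set_itv1.
  apply: normal_prob_itv_cvg.
  - move=> m n mn; rewrite ler_wpM2r ?(ltW r0)// lef_pV2 ?posrE//.
    by rewrite ler_nat ltnS.
  - by move=> n; rewrite mulr_gt0.
  - by rewrite -(mul0r r); apply: cvgM; [exact: cvg_harmonic|exact: cvg_cst].
have lim2 : normal_prob 0 1 `](- (c n * r))%R, (c n * r)%R]%classic +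
    normal_prob 0 1 `](- (c n * r))%R, (c n * r)%R]%classic @[n --> \oo] --> (0 : \bar R).
  by rewrite -[X in _ --> X]adde0; apply: cvgeD.
apply: (cvge_to_ge lim2).
by apply: nearW => n; exact: bound.
Qed.

End last_zero_law.

(** * The coupling *)

Section transfer.
Context {R : realType}.

Lemma standard_BM_transfer d (T : measurableType d) (P : probability T R) (b : T -> W R)
    d' (T' : measurableType d') (P' : probability T' R) (b' : T' -> W R) :
  measurable_fun setT b' ->
  (forall U, measurable U -> P' (b' @^-1` U) = P (b @^-1` U)) ->
  standard_BM P b -> standard_BM P' b'.
Proof.
move=> mb' law [mb b0 bind bincr]; split => //.
- rewrite -b0; apply: (law [set w : W R | w time0 = 0]).
  rewrite -[X in measurable X]setTI.
  exact: (@measurable_eval R time0 measurableT [set 0] (measurable_set1 _)).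
- move=> n t mt A mA.
  have incr_law (i : 'I_n) : P' ((fun x => b' x (t i.+1) - b' x (t i)) @^-1` A i) =
      P ((fun x => b x (t i.+1) - b x (t i)) @^-1` A i).
    apply: (law [set w : W R | A i (w (t i.+1) - w (t i))]); exact: measurable_incr_set.
  under eq_bigr do rewrite incr_law.
  rewrite -(bind n t mt A mA).
  apply: (law (\bigcap_(i in [set: 'I_n]) [set w : W R | A i (w (t i.+1) - w (t i))])).
  apply: fin_bigcap_measurable; first exact: finite_finset.
  by move=> i _; exact: measurable_incr_set.
- move=> s t st; have [mX lawX] := bincr s t st; split.
    exact: (measurableT_comp (measurable_incr s t) mb').
  move=> A mA; rewrite -lawX//.
  by apply: (law [set w : W R | A (w t - w s)]); exact: measurable_incr_set.
Qed.

Lemma add_driftD (c e : R) (w : W R) : add_drift c (add_drift e w) = add_drift (c + e) w.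
Proof. by apply: path_ext => t; rewrite !add_driftE mulrDl addrCA addrC -addrA. Qed.

Lemma add_drift0 (w : W R) : add_drift 0 w = w.
Proof. by apply: path_ext => t; rewrite add_driftE mul0r addr0. Qed.

End transfer.

Section fragmentation.
Context {R : realType}.
Implicit Types (w : W R) (t u : time R).

Lemma zero_after_le w t u : val t <= val u -> zero_after w u -> zero_after w t.
Proof. by move=> tu [v uv wv]; exists v => //; exact: le_trans uv. Qed.

Lemma Hmap_neq theta w t : w t <> Hmap theta w t <->
  ~ zero_after (add_drift (- (2^-1 * theta)) w) t.
Proof.
rewrite HmapE; have [tL|tL] := boolP (_ <= _)%E.
  by split => // nz; exfalso; apply: nz; exact/last_visitP.
have nz : ~ zero_after (add_drift (- (2^-1 * theta)) w) t.
  by move=> /last_visitP; apply/negP.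
split => // _ wt; apply: nz; exists t => //.
by rewrite add_driftE; lra.
Qed.

(** The paths differ exactly at the times after the last zero; the margins
    1 / (n + 1) are there because the infimum need not be attained. *)
Lemma tau_frag_le theta w (t : R) : 0 <= t ->
  (tau_frag w (Hmap theta w) <= t%:E)%E <->
  forall n : nat, no_zero_after (2^-1 * theta) (to_time (t + n.+1%:R^-1)) w.
Proof.
move=> t0; have tn0 n : 0 <= t + n.+1%:R^-1 by rewrite addr_ge0.
split => [taut n|nz].
  have : (tau_frag w (Hmap theta w) < (t + n.+1%:R^-1)%:E)%E.
    by rewrite (le_lt_trans taut)// lte_fin ltrDl invr_gt0.
  move=> /ereal_inf_lt [_ [u /= /Hmap_neq nzu <-]]; rewrite lte_fin => ut /zero_after_le h.
  by apply: nzu; apply: h; rewrite val_to_time// ltW.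
apply/lee_addgt0Pr => e e0.
have := nz (Num.truncn e^-1) => /Hmap_neq ntau.
set n := Num.truncn e^-1 in ntau.
apply: (@le_trans _ _ (t + n.+1%:R^-1)%:E).
  apply: ereal_inf_lbound; exists (to_time (t + n.+1%:R^-1)) => //.
  by congr EFin; exact: val_to_time.
rewrite -EFinD lee_fin lerD2l -[leRHS]invrK lef_pV2 ?posrE ?invr_gt0//.
by rewrite ltW// truncnS_gt.
Qed.

Lemma tau_frag_le_bigcap theta (t : R) : 0 <= t ->
  [set w : W R | (tau_frag w (Hmap theta w) <= t%:E)%E] =
  \bigcap_n no_zero_after (2^-1 * theta) (to_time (t + n.+1%:R^-1)).
Proof.
move=> t0; apply/seteqP; split => w /=.
  by move=> /(tau_frag_le theta w t0) h n _; exact: h.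
by move=> h; apply/tau_frag_le => // n; exact: h.
Qed.

End fragmentation.

Section main.
Context {R : realType} (nu : probability (W R) R).
Context (bm : standard_BM nu (fun w : W R => w)).

Lemma no_zero_after_law_norm (c : R) (t : time R) : c != 0 -> 0 < val t ->
  nu (no_zero_after c t) =
  normal_prob 0 1 `](- (`|c| * Num.sqrt (val t))), (`|c| * Num.sqrt (val t))]%classic.
Proof.
move=> c0 t0; have [cgt0|clt0|cE] := ltgtP c 0.
- rewrite -(no_zero_after_law bm _ t0) ?normr_gt0// ltr0_norm// no_zero_afterN//.
- by rewrite -(no_zero_after_law bm _ t0) ?normr_gt0// gtr0_norm.
- by rewrite cE eqxx in c0.
Qed.

Lemma tau_frag_law (theta t : R) : 0 <= t -> theta != 0 ->
  nu [set w | (tau_frag w (Hmap theta w) <= t%:E)%E] =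
  normal_prob 0 1 `[- (`|2^-1 * theta| * Num.sqrt t), (`|2^-1 * theta| * Num.sqrt t)]%classic.
Proof.
move=> t0 theta0; pose c := 2^-1 * theta; pose tn (n : nat) := t + n.+1%:R^-1.
have c0 : 0 < `|c| by rewrite normr_gt0 mulf_neq0// invr_eq0 pnatr_eq0.
have tn0 n : 0 < tn n by rewrite ltr_wpDl// invr_gt0.
have tnE n : val (to_time (tn n)) = tn n by rewrite val_to_time// ltW.
have tn_le m n : (m <= n)%N -> tn n <= tn m.
  by move=> mn; rewrite lerD2l lef_pV2 ?posrE// ler_nat ltnS.
pose S n := no_zero_after c (to_time (tn n)).
have mS n : measurable (S n) by exact: measurable_no_zero_after.
rewrite tau_frag_le_bigcap// -/(S _).
have lim1 : nu (S n) @[n --> \oo] --> nu (\bigcap_n S n).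
  apply: nonincreasing_cvg_mu => //.
  - by rewrite (le_lt_trans (probability_le1 nu (mS 0%N)))// ltry.
  - exact: bigcapT_measurable.
  - move=> m n mn; apply/subsetPset => w Sn /zero_after_le h; apply: Sn; apply: h.
    by rewrite !tnE tn_le.
have SE n : nu (S n) = normal_prob 0 1 `](- (`|c| * Num.sqrt (tn n))), (`|c| * Num.sqrt (tn n))]%classic.
  by rewrite no_zero_after_law_norm ?tnE// -normr_gt0.
have lim2 : nu (S n) @[n --> \oo] -->
    normal_prob 0 1 `[- (`|c| * Num.sqrt t), (`|c| * Num.sqrt t)]%classic.
  under eq_fun do rewrite SE.
  apply: (@normal_prob_itv_cvg R _ (fun n => `|c| * Num.sqrt (tn n))).
  - by move=> m n mn; rewrite ler_wpM2l ?ler_wsqrtr// tn_le.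
  - by move=> n; rewrite ltr_pM2l// ltr_sqrt// ltrDl invr_gt0.
  - apply: cvgM; first exact: cvg_cst.
    have tn_cvg : tn n @[n --> \oo] --> (t + 0 : R).
      by apply: cvgD; [exact: cvg_cst|exact: cvg_harmonic].
    rewrite addr0 in tn_cvg.
    exact: (cvg_comp tn Num.sqrt tn_cvg (@sqrt_continuous R t)).
exact: cvg_unique lim1 lim2.
Qed.

Lemma tau_frag_law0 (t : R) : 0 <= t ->
  nu [set w | (tau_frag w (Hmap 0 w) <= t%:E)%E] = 0%E.
Proof.
move=> t0; apply: (@subset_measure0 _ _ _ nu _ (no_zero_after 0 (to_time (t + 1)))).
- by rewrite tau_frag_le_bigcap//; apply: bigcapT_measurable => n; exact: measurable_no_zero_after.
- exact: measurable_no_zero_after.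
- move=> w /= /(tau_frag_le _ _ t0) /(_ 0%N).
  by rewrite mulr0 invr1.
- by apply: (no_zero_after0 bm); rewrite val_to_time ?ltr_wpDl// addr_ge0.
Qed.

End main.

Theorem theorem2p2 (R : realType) (d : measure_display)
    (Omega : measurableType d) (P : probability Omega R)
    (B : Omega -> W R) (hB : has_BM_law P 0 B) (theta : R) :
  has_BM_law P theta (fun x => Hmap theta (B x)) /\
  maximally_germ_coupled P theta B (fun x => Hmap theta (B x)).
Proof.
case: (hB) => d' [T' [P' [b [bmb [mB lawB]]]]].
pose X : {mfun Omega >-> W R} := HB.pack B (isMeasurableFun.Build _ _ _ _ _ mB).
pose nu : probability (W R) R := distribution P X.
have bm : standard_BM nu (fun w : W R => w).
  apply: (standard_BM_transfer _ _ bmb); first exact: measurable_id.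
  move=> U mU; rewrite [LHS]lawB//; congr (P' _); apply/seteqP; split => x /=; by rewrite add_drift0.
have HB_law : has_BM_law P theta (fun x => Hmap theta (B x)).
  exists d, Omega, P, (fun x => add_drift (- theta) (Hmap theta (B x))).
  pose c := 2^-1 * theta.
  have thetaE : - theta = - c + - c by rewrite /c; field.
  have mH : measurable_fun setT (fun x => Hmap theta (B x)).
    exact: (measurableT_comp (measurable_Hmap theta) mB).
  split; last first.
    split => // A mA; congr (P _).
    by apply/seteqP; split => x; rewrite /= add_driftD subrr add_drift0.
  apply: (standard_BM_transfer _ _ bm).
    exact: (measurableT_comp (measurable_add_drift (- theta)) mH).
  move=> U mU.
  have mU' : measurable (add_drift (- c) @^-1` U : set (W R)).
    by rewrite -[X in measurable X]setTI; exact: measurable_add_drift.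
  transitivity (nu ((fun w => add_drift (- c) (Hmap theta w)) @^-1` (add_drift (- c) @^-1` U))).
    by congr (P _); apply/seteqP; split => x; rewrite /= add_driftD thetaE.
  rewrite (Hmap_law bm theta mU'); congr (nu _).
  by apply/seteqP; split => w; rewrite /= add_driftD addNr add_drift0.
split => //; split => // d1 Omega1 P1 Z [mZ lawZ] t t0.
transitivity (nu [set w | (tau_frag w (Hmap theta w) <= t%:E)%E]); first by [].
have [->|theta0] := eqVneq theta 0.
  rewrite (tau_frag_law0 bm t0) (_ : mkset _ = set0) ?measure0//.
  by apply/seteqP; split => // x; rewrite /germ_time/= eqxx.
rewrite (tau_frag_law bm t0 theta0) -lawZ//; congr (P1 _).
have germE x : (4 * theta ^- 2 * x ^+ 2 <= t) = (`|x| <= `|2^-1 * theta| * Num.sqrt t).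
  rewrite -[RHS]ler_sqr ?nnegrE ?mulr_ge0// exprMn sqr_sqrtr// -!normrX.
  rewrite !ger0_norm ?sqr_ge0// exprMn -ler_pdivrMl; last first.
    by rewrite mulr_gt0// ?exprn_even_gt0//= invr_neq0.
  by congr (_ <= _); field.
by apply/seteqP; split => x; rewrite /germ_time/= (negbTE theta0) lee_fin in_itv/= -ler_norml germE.
Qed.
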